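(* Let $\Bbbk$ be a field of characteristic $0$. For any monoid $\mathbf{a}$ in species over $\Bbbk$, the maps $$\exp:\{s\in\mathscr{S}(\mathbf{a})\mid s_\emptyset=0\}\to\{t\in\mathscr{S}(\mathbf{a})\mid t_\emptyset=\iota_\emptyset(1)\},\qquad \log:\{t\in\mathscr{S}(\mathbf{a})\mid t_\emptyset=\iota_\emptyset(1)\}\to\{s\in\mathscr{S}(\mathbf{a})\mid s_\emptyset=0\}$$ are inverse bijections. Moreover, if $\mathbf{h}$ is a connected bimonoid, these maps (for $\mathbf{a}=\mathbf{h}$) restrict to inverse bijections $\exp:\mathscr{P}(\mathbf{h})\to\mathscr{G}(\mathbf{h})$ and $\log:\mathscr{G}(\mathbf{h})\to\mathscr{P}(\mathbf{h})$ between the set of primitive series and the set of group-like series of $\mathbf{h}$.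
   Context: Species and bimonoids. A species is a functor $\mathbf{p}$ from the category of finite sets and bijections to $\Bbbk$-vector spaces, $I\mapsto\mathbf{p}[I]$; morphisms are natural transformations. $I=S\sqcup T$ means that $(S,T)$ is an ordered pair of disjoint, possibly empty, subsets with union $I$. The Cauchy product is $(\mathbf{p}\cdot\mathbf{q})[I]=\bigoplus_{I=S\sqcup T}\mathbf{p}[S]\otimes\mathbf{q}[T]$; with the symmetry $x\otimes y\mapsto y\otimes x$ and unit the species that is $\Bbbk$ on $\emptyset$ and $0$ elsewhere, species form a symmetric monoidal category. Monoids, comonoids and bimonoids are taken in this category: a monoid has natural maps $\mu_{S,T}:\mathbf{a}[S]\otimes\mathbf{a}[T]\to\mathbf{a}[I]$ and $\iota_\emptyset:\Bbbk\to\mathbf{a}[\emptyset]$ (associative, unital); a comonoid has natural maps $\Delta_{S,T}:\mathbf{c}[I]\to\mathbf{c}[S]\otimes\mathbf{c}[T]$ and $\epsilon_\emptyset:\mathbf{c}[\emptyset]\to\Bbbk$ (coassociative, counital); in a bimonoid, product and unit are morphisms of comonoids. A bimonoid $\mathbf{h}$ is connected if $\dim\mathbf{h}[\emptyset]=1$. A composition $F=(I_1,\dots,I_k)\vDash I$ is a sequence of pairwise disjoint nonempty subsets with union $I$; $\ell(F)=k$. The empty set has exactly one composition (with no blocks). For a monoid, $\mu_F:\mathbf{a}[I_1]\otimes\dots\otimes\mathbf{a}[I_k]\to\mathbf{a}[I]$ is the iterated product (the identity if $k=1$, $\iota_\emptyset$ if $k=0$). Series. A series $s$ of a species $\mathbf{p}$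 is a family $s_I\in\mathbf{p}[I]$, one for each finite set $I$, with $\mathbf{p}[\sigma](s_I)=s_J$ for every bijection $\sigma:I\to J$; the space of series is $\mathscr{S}(\mathbf{p})$. Write $s_F=s_{I_1}\otimes\cdots\otimes s_{I_k}$. For series $s,t$ of a monoid $\mathbf{a}$ with $s_\emptyset=0$ and $t_\emptyset=\iota_\emptyset(1)$, $$\exp(s)_I=\sum_{F\vDash I}\frac{1}{\ell(F)!}\mu_F(s_F),\qquad \log(t)_\emptyset=0,\quad \log(t)_I=\sum_{F\vDash I}\frac{(-1)^{\ell(F)-1}}{\ell(F)}\mu_F(t_F)\ (I\neq\emptyset).$$ A series $g$ of a comonoid is group-like if $\Delta_{S,T}(g_I)=g_S\otimes g_T$ for all $I=S\sqcup T$ and $\epsilon_\emptyset(g_\emptyset)=1$; $\mathscr{G}(\mathbf{h})$ is the set of these. A series $x$ of a connected comonoid is primitive if $x_\emptyset=0$ and $\Delta_{S,T}(x_I)=0$ for all $I=S\sqcup T$ with $S,T\ne\emptyset$; $\mathscr{P}(\mathbf{h})$ is the set of these. *)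

(* Defs.v *)
From HB Require Import structures.
From mathcomp Require Import all_boot all_order all_algebra.
From mathcomp Require Import finmap generic_quotient boolp.

Set Implicit Arguments.
Unset Strict Implicit.
Unset Printing Implicit Defensive.

Import GRing.Theory.
Local Open Scope ring_scope.
Local Open Scope quotient_scope.

(* Tensor product of two vector spaces: the free commutative monoid on V * W
   (formal sums, as lists) modulo the congruence generated by bilinearity. *)
Section TensorQuotient.
Variables (k : fieldType) (V W : lmodType k).

Inductive tensor_rel : seq (V * W) -> seq (V * W) -> Prop :=
| TensorRefl s : tensor_rel s s
| TensorSym s t : tensor_rel s t -> tensor_rel t s
| TensorTrans s t u : tensor_rel s t -> tensor_rel t u -> tensor_rel s u
| TensorCat s s' t t' :
    tensor_rel s s' -> tensor_rel t t' -> tensor_rel (s ++ t) (s' ++ t')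
| TensorCatC s t : tensor_rel (s ++ t) (t ++ s)
| TensorDl v v' w : tensor_rel [:: (v + v', w)] [:: (v, w); (v', w)]
| TensorDr v w w' : tensor_rel [:: (v, w + w')] [:: (v, w); (v, w')]
| TensorZ a v w : tensor_rel [:: (a *: v, w)] [:: (v, a *: w)]
| Tensor0 w : tensor_rel [:: (0, w)] [::].

Definition tensor_eqb (s t : seq (V * W)) : bool := `[< tensor_rel s t >].

Lemma tensor_eqb_refl : reflexive tensor_eqb.
Proof. by move=> s; apply/asboolP/TensorRefl. Qed.

Lemma tensor_eqb_sym : symmetric tensor_eqb.
Proof. by move=> s t; apply/asboolP/asboolP; apply: TensorSym. Qed.

Lemma tensor_eqb_trans : transitive tensor_eqb.
Proof.
by move=> t s u /asboolP st /asboolP tu; apply/asboolP/(TensorTrans st tu).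
Qed.

Canonical tensor_equiv :=
  EquivRel tensor_eqb tensor_eqb_refl tensor_eqb_sym tensor_eqb_trans.

Definition tensor := {eq_quot tensor_equiv}.
HB.instance Definition _ := Choice.on tensor.
HB.instance Definition _ := EqQuotient.on tensor.

Lemma tensor_piP s t : tensor_rel s t <-> \pi_tensor s = \pi_tensor t.
Proof. by split=> [st|/eqmodP/asboolP//]; apply/eqmodP/asboolP. Qed.

Lemma tensor_reprP s : tensor_rel (repr (\pi_tensor s)) s.
Proof. by apply/tensor_piP; rewrite reprK. Qed.

Definition tensor_scale_seq (a : k) (s : seq (V * W)) : seq (V * W) :=
  [seq (a *: p.1, p.2) | p <- s].

Definition tensor_add (x y : tensor) : tensor := \pi_tensor (repr x ++ repr y).
Definition tensor_scale (a : k) (x : tensor) : tensor :=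
  \pi_tensor (tensor_scale_seq a (repr x)).
Definition tensor_opp (x : tensor) : tensor := tensor_scale (-1) x.
Definition tensor_zero : tensor := \pi_tensor [::].

Lemma tensor_rel_scale a s t : tensor_rel s t ->
  tensor_rel (tensor_scale_seq a s) (tensor_scale_seq a t).
Proof.
elim=> {s t} [s|s t _|s t u _ IH1 _ IH2|s s' t t' _ IH1 _ IH2|s t
             |v v' w|v w w'|b v w|w] /=.
- exact: TensorRefl.
- exact: TensorSym.
- exact: TensorTrans IH1 IH2.
- by rewrite /tensor_scale_seq !map_cat; apply: TensorCat.
- by rewrite /tensor_scale_seq !map_cat; apply: TensorCatC.
- by rewrite scalerDr; apply: TensorDl.
- exact: TensorDr.
- by rewrite scalerA mulrC -scalerA; apply: TensorZ.
- by rewrite scaler0; apply: Tensor0.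
Qed.

Lemma tensor_addE s t :
  tensor_add (\pi_tensor s) (\pi_tensor t) = \pi_tensor (s ++ t).
Proof. by apply/tensor_piP/TensorCat; apply: tensor_reprP. Qed.

Lemma tensor_scaleE a s :
  tensor_scale a (\pi_tensor s) = \pi_tensor (tensor_scale_seq a s).
Proof. by apply/tensor_piP/tensor_rel_scale/tensor_reprP. Qed.

Lemma tensor_ind (P : tensor -> Prop) :
  (forall s, P (\pi_tensor s)) -> forall x, P x.
Proof. by move=> Ps x; rewrite -[x]reprK. Qed.

Lemma tensor_addA : associative tensor_add.
Proof.
elim/tensor_ind=> s; elim/tensor_ind=> t; elim/tensor_ind=> u.
by rewrite !tensor_addE catA.
Qed.

Lemma tensor_addC : commutative tensor_add.
Proof.
elim/tensor_ind=> s; elim/tensor_ind=> t; rewrite !tensor_addE.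
by apply/tensor_piP/TensorCatC.
Qed.

Lemma tensor_add0 : left_id tensor_zero tensor_add.
Proof. by elim/tensor_ind=> s; rewrite tensor_addE. Qed.

Lemma tensor_rel_scaleD a b s :
  tensor_rel (tensor_scale_seq (a + b) s)
             (tensor_scale_seq a s ++ tensor_scale_seq b s).
Proof.
elim: s => [|[v w] s IHs]; first exact: TensorRefl.
rewrite /= scalerDl.
apply: TensorTrans (TensorCat (TensorDl _ _ _) IHs) _.
apply: (@TensorCat [:: _] [:: _]); first exact: TensorRefl.
rewrite -cat_cons -[X in tensor_rel _ (_ ++ X)]cat1s catA.
apply: (@TensorTrans _ (([:: (b *: v, w)] ++ tensor_scale_seq a s)
                          ++ tensor_scale_seq b s)); first exact: TensorRefl.
by apply: TensorCat (TensorCatC _ _) (TensorRefl _).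
Qed.

Lemma tensor_rel_scale0 s : tensor_rel (tensor_scale_seq 0 s) [::].
Proof.
elim: s => [|[v w] s IHs]; first exact: TensorRefl.
by rewrite /= scale0r; apply: (TensorCat (Tensor0 w) IHs).
Qed.

Lemma tensor_scale1 : left_id 1 tensor_scale.
Proof.
elim/tensor_ind=> s; rewrite tensor_scaleE; congr (\pi_tensor _).
by elim: s => //= -[v w] s ->; rewrite scale1r.
Qed.

Lemma tensor_addN : left_inverse tensor_zero tensor_opp tensor_add.
Proof.
elim/tensor_ind=> s; rewrite /tensor_opp -{2}[\pi_tensor s]tensor_scale1.
rewrite !tensor_scaleE tensor_addE; apply/tensor_piP.
apply: TensorTrans (TensorSym (tensor_rel_scaleD _ _ _)) _.
by rewrite addNr; apply: tensor_rel_scale0.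
Qed.

HB.instance Definition _ := GRing.isZmodule.Build tensor
  tensor_addA tensor_addC tensor_add0 tensor_addN.

Lemma tensor_scaleA a b x :
  tensor_scale a (tensor_scale b x) = tensor_scale (a * b) x.
Proof.
elim/tensor_ind: x => s; rewrite !tensor_scaleE; congr (\pi_tensor _).
by elim: s => //= -[v w] s ->; rewrite scalerA.
Qed.

Lemma tensor_scaleDr : right_distributive tensor_scale +%R.
Proof.
move=> a; elim/tensor_ind=> s; elim/tensor_ind=> t; rewrite /GRing.add /=.
by rewrite tensor_addE !tensor_scaleE tensor_addE /tensor_scale_seq map_cat.
Qed.

Lemma tensor_scaleDl x : {morph tensor_scale^~ x : a b / a + b}.
Proof.
move=> a b; elim/tensor_ind: x => s; rewrite /GRing.add /=.
by rewrite !tensor_scaleE tensor_addE; apply/tensor_piP/tensor_rel_scaleD.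
Qed.

HB.instance Definition _ := GRing.Zmodule_isLmodule.Build k tensor
  tensor_scaleA tensor_scale1 tensor_scaleDr tensor_scaleDl.

Definition tens (v : V) (w : W) : tensor := \pi_tensor [:: (v, w)].

Lemma tensor_piD s t : \pi_tensor (s ++ t) = \pi_tensor s + \pi_tensor t.
Proof. by rewrite -tensor_addE. Qed.

Lemma tensor_piE s : \pi_tensor s = \sum_(p <- s) tens p.1 p.2.
Proof.
elim: s => [|[v w] s IHs]; first by rewrite big_nil.
by rewrite big_cons -IHs -cat1s tensor_piD.
Qed.

Lemma tensor_sum (x : tensor) : x = \sum_(p <- repr x) tens p.1 p.2.
Proof. by rewrite -tensor_piE reprK. Qed.

Lemma tensDl v v' w : tens (v + v') w = tens v w + tens v' w.
Proof. by rewrite -tensor_piD; apply/tensor_piP/TensorDl. Qed.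

Lemma tensDr v w w' : tens v (w + w') = tens v w + tens v w'.
Proof. by rewrite -tensor_piD; apply/tensor_piP/TensorDr. Qed.

Lemma tensZl a v w : tens (a *: v) w = a *: tens v w.
Proof. by rewrite /GRing.scale /= [RHS]tensor_scaleE. Qed.

Lemma tensZr a v w : tens v (a *: w) = a *: tens v w.
Proof. by rewrite -tensZl; apply/esym/tensor_piP/TensorZ. Qed.

(* tensor_lift f is the linear map induced by f when f is bilinear, and is
   meaningless otherwise. *)
Definition is_bilinear (Z : lmodType k) (f : V -> W -> Z) : Prop :=
  (forall w, linear (f^~ w)) /\ (forall v, linear (f v)).

Lemma tens_bilinear : is_bilinear tens.
Proof.
by split=> [w a u v|v a u w]; rewrite (tensDl, tensDr) (tensZl, tensZr).
Qed.

Definition tensor_lift (Z : lmodType k) (f : V -> W -> Z) (x : tensor) : Z :=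
  \sum_(p <- repr x) f p.1 p.2.

Section Lift.
Variables (Z : lmodType k) (f : V -> W -> Z) (f_bil : is_bilinear f).

Lemma tensor_lift_pi s :
  tensor_lift f (\pi_tensor s) = \sum_(p <- s) f p.1 p.2.
Proof.
have [fl fr] := f_bil.
have f0 w : f 0 w = 0.
  by have := fl w 1 0 0; rewrite !scale1r addr0 => /esym/(canRL (addrK _));
     rewrite subrr.
rewrite /tensor_lift; move: (repr _) (tensor_reprP s) => r rs.
elim: {r s} rs => [s|s t _ IH|s t u _ IH1 _ IH2|s s' t t' _ IH1 _ IH2|s t
             |v v' w|v w w'|b v w|w] //.
- by rewrite IH1 IH2.
- by rewrite !big_cat /= IH1 IH2.
- by rewrite !big_cat /= addrC.
- by rewrite !big_cons !big_nil !addr0 /=; have := fl w 1 v v'; rewrite !scale1r.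
- by rewrite !big_cons !big_nil !addr0 /=; have := fr v 1 w w'; rewrite !scale1r.
- rewrite !big_cons !big_nil !addr0 /=.
  have fr0 : f v 0 = 0.
    by have := fr v 1 0 0; rewrite !scale1r addr0 => /esym/(canRL (addrK _));
       rewrite subrr.
  have := fl w b v 0; have := fr v b w 0.
  by rewrite !addr0 f0 fr0 !addr0 => -> ->.
- by rewrite big_cons !big_nil /= f0 addr0.
Qed.

Lemma tensor_lift_tens v w : tensor_lift f (tens v w) = f v w.
Proof. by rewrite tensor_lift_pi big_seq1. Qed.

Lemma tensor_lift_linear : linear (tensor_lift f).
Proof.
have [fl fr] := f_bil => a.
elim/tensor_ind=> s; elim/tensor_ind=> t.
have -> : a *: \pi_tensor s = \pi_tensor (tensor_scale_seq a s).
  exact: tensor_scaleE.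
rewrite -tensor_piD !tensor_lift_pi big_cat /= big_map scaler_sumr.
congr (_ + _); apply: eq_bigr => -[v w] _ /=.
have := fl w 1 0 0; rewrite !scale1r addr0 => /esym/(canRL (addrK _)).
by rewrite subrr => f0; have := fl w a v 0; rewrite !addr0 f0 addr0.
Qed.

End Lift.

End TensorQuotient.

Lemma tensor_lift_linearP (k : fieldType) (V W Z : lmodType k)
    (f g : tensor V W -> Z) : linear f -> linear g ->
  (forall v w, f (tens v w) = g (tens v w)) -> f =1 g.
Proof.
move=> f_lin g_lin fg x; rewrite [x]tensor_sum.
pose F : {linear tensor V W -> Z} :=
  HB.pack f (GRing.isLinear.Build _ _ _ _ f f_lin).
pose G : {linear tensor V W -> Z} :=
  HB.pack g (GRing.isLinear.Build _ _ _ _ g g_lin).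
rewrite -[LHS]/(F _) -[RHS]/(G _) !linear_sum.
by apply: eq_bigr => p _; apply: fg.
Qed.

Section TensorMaps.
Variable k : fieldType.
Implicit Types A B C D V W : lmodType k.

Definition tensor_map V V' W W' (f : {linear V -> V'}) (g : {linear W -> W'})
    : tensor V W -> tensor V' W' :=
  tensor_lift (fun v w => tens (f v) (g w)).

Definition tensor_assoc A B C : tensor (tensor A B) C -> tensor A (tensor B C) :=
  tensor_lift (fun x c => tensor_lift (fun a b => tens a (tens b c)) x).

(* id (x) beta (x) id up to associators: (a (x) b) (x) (c (x) d) is sent to
   (a (x) c) (x) (b (x) d) *)
Definition tensor_swap4 A B C D :
    tensor (tensor A B) (tensor C D) -> tensor (tensor A C) (tensor B D) :=
  tensor_lift (fun x y =>
    tensor_lift (fun a b =>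
      tensor_lift (fun c d => tens (tens a c) (tens b d)) y) x).

Lemma tensor_map_bilinear V V' W W' (f : {linear V -> V'})
    (g : {linear W -> W'}) : is_bilinear (fun v w => tens (f v) (g w)).
Proof.
by split=> [w a u v|v a u w]; rewrite linearP (tensDl, tensDr) (tensZl, tensZr).
Qed.

Lemma tensor_map_tens V V' W W' (f : {linear V -> V'}) (g : {linear W -> W'})
    v w : tensor_map f g (tens v w) = tens (f v) (g w).
Proof. by rewrite /tensor_map tensor_lift_tens //; apply: tensor_map_bilinear. Qed.

Lemma tensor_map_linear V V' W W' (f : {linear V -> V'})
    (g : {linear W -> W'}) : linear (tensor_map f g).
Proof. exact: tensor_lift_linear (tensor_map_bilinear f g). Qed.

HB.instance Definition _ V V' W W' (f : {linear V -> V'})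
    (g : {linear W -> W'}) :=
  GRing.isLinear.Build k (tensor V W) (tensor V' W') _ (tensor_map f g)
    (tensor_map_linear f g).

Lemma tensor_lift_add V W (Z : lmodType k) (f g h : V -> W -> Z) (a : k) :
  (forall v w, h v w = a *: f v w + g v w) ->
  forall x, tensor_lift h x = a *: tensor_lift f x + tensor_lift g x.
Proof.
move=> hE x; rewrite /tensor_lift scaler_sumr -big_split /=.
by apply: eq_bigr => p _; apply: hE.
Qed.

Lemma tensor_assoc_bilinear1 A B C (c : C) :
  is_bilinear (fun (a : A) (b : B) => tens a (tens b c)).
Proof.
by split=> [w a u v|v a u w]; rewrite ?tensDl ?tensDr ?tensZl ?tensZr ?tensDr.
Qed.

Lemma tensor_assoc_bilinear A B C : is_bilinear (fun (x : tensor A B) (c : C) =>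
  tensor_lift (fun a b => tens a (tens b c)) x).
Proof.
split=> [w|x a u v]; first exact: (tensor_lift_linear (@tensor_assoc_bilinear1 A B C w)).
by apply: tensor_lift_add => v' w'; rewrite !tensDr !tensZr.
Qed.

Lemma tensor_assoc_tens A B C (a : A) (b : B) (c : C) :
  tensor_assoc (tens (tens a b) c) = tens a (tens b c).
Proof.
rewrite /tensor_assoc tensor_lift_tens; last exact: tensor_assoc_bilinear.
by rewrite tensor_lift_tens //; apply: tensor_assoc_bilinear1.
Qed.

Lemma tensor_assoc_linear A B C : linear (@tensor_assoc A B C).
Proof. exact: tensor_lift_linear (@tensor_assoc_bilinear A B C). Qed.

HB.instance Definition _ A B C :=
  GRing.isLinear.Build k (tensor (tensor A B) C) (tensor A (tensor B C)) _
    (@tensor_assoc A B C) (@tensor_assoc_linear A B C).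

Lemma tensor_swap4_bilinear1 A B C D (a : A) (b : B) :
  is_bilinear (fun (c : C) (d : D) => tens (tens a c) (tens b d)).
Proof.
by split=> [w e u v|v e u w]; rewrite ?tensDr ?tensZr ?tensDl ?tensZl ?tensDr
  ?tensZr.
Qed.

Lemma tensor_swap4_bilinear2 A B C D (y : tensor C D) :
  is_bilinear (fun (a : A) (b : B) =>
    tensor_lift (fun c d => tens (tens a c) (tens b d)) y).
Proof.
by split=> [w e u v|v e u w]; apply: tensor_lift_add => c d;
  rewrite !(tensDl, tensZl, tensDr, tensZr).
Qed.

Lemma tensor_swap4_bilinear A B C D :
  is_bilinear (fun (x : tensor A B) (y : tensor C D) =>
    tensor_lift (fun a b =>
      tensor_lift (fun c d => tens (tens a c) (tens b d)) y) x).
Proof.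
split=> [y|x e u v]; first exact: (tensor_lift_linear (@tensor_swap4_bilinear2 A B C D y)).
apply: tensor_lift_add => a b.
exact: (tensor_lift_linear (@tensor_swap4_bilinear1 A B C D a b)).
Qed.

Lemma tensor_swap4_tens A B C D (a : A) (b : B) (c : C) (d : D) :
  tensor_swap4 (tens (tens a b) (tens c d)) = tens (tens a c) (tens b d).
Proof.
rewrite /tensor_swap4 tensor_lift_tens; last exact: tensor_swap4_bilinear.
rewrite tensor_lift_tens; last exact: tensor_swap4_bilinear2.
by rewrite tensor_lift_tens //; apply: tensor_swap4_bilinear1.
Qed.

Lemma tensor_swap4_linear A B C D : linear (@tensor_swap4 A B C D).
Proof. exact: tensor_lift_linear (@tensor_swap4_bilinear A B C D). Qed.

HB.instance Definition _ A B C D :=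
  GRing.isLinear.Build k (tensor (tensor A B) (tensor C D))
    (tensor (tensor A C) (tensor B D)) _
    (@tensor_swap4 A B C D) (@tensor_swap4_linear A B C D).

End TensorMaps.

Local Open Scope fset_scope.

(* Finite sets are the finite subsets A : {fset K} of arbitrary types
   K : choiceType, so each K has its own empty set fset0. Morphisms are the
   bijections between their types of elements; sp_map does not depend on the
   proof of bijectivity, by boolp.Prop_irrelevance. *)
Record species (k : fieldType) : Type := Species {
  sp_obj :> forall K : choiceType, {fset K} -> lmodType k;
  sp_map : forall (K L : choiceType) (A : {fset K}) (B : {fset L})
    (f : A -> B), bijective f -> {linear sp_obj A -> sp_obj B};
  sp_map_id : forall (K : choiceType) (A : {fset K})
    (hid : bijective (fun x : A => x)) (u : sp_obj A),
    sp_map hid u = u;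
  sp_map_comp : forall (K L M : choiceType)
    (A : {fset K}) (B : {fset L}) (C : {fset M}) (f : A -> B) (g : B -> C)
    (hf : bijective f) (hg : bijective g) (hgf : bijective (fun x => g (f x)))
    (u : sp_obj A),
    sp_map hgf u = sp_map hg (sp_map hf u)
}.
Arguments sp_map {k} p {K L A B f} : rename.

(* I is the disjoint union of the ordered pair (S, T) *)
Definition decomp (K : choiceType) (I S T : {fset K}) : bool :=
  [disjoint S & T]%fset && (S `|` T == I).

(* f is the restriction of h to S, when S and S' are subsets of I and I' *)
Definition restricts (K L : choiceType) (I S : {fset K}) (I' S' : {fset L})
    (h : I -> I') (f : S -> S') : Prop :=
  forall (i : I) (x : S), val i = val x -> val (h i) = val (f x).

(* Structures for the Cauchy product, given by their components. In the
   (co)associativity axioms I is the disjoint union of R, S and T, with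
   RS = R `|` S and ST = S `|` T. *)
Record monoid_structure (k : fieldType) (a : species k) : Type := Monoid {
  mu : forall (K : choiceType) (I S T : {fset K}), decomp I S T ->
    {linear tensor (a K S) (a K T) -> a K I};
  iota0 : forall K : choiceType, {linear k^o -> a K fset0};
  mu_natural : forall (K L : choiceType)
    (I S T : {fset K}) (I' S' T' : {fset L})
    (d : decomp I S T) (d' : decomp I' S' T')
    (h : I -> I') (f : S -> S') (g : T -> T')
    (hh : bijective h) (hf : bijective f) (hg : bijective g),
    restricts h f -> restricts h g ->
    forall x : tensor (a K S) (a K T),
      sp_map a hh (mu d x) = mu d' (tensor_map (sp_map a hf) (sp_map a hg) x);
  iota0_natural : forall (K L : choiceType)
    (f : (fset0 : {fset K}) -> (fset0 : {fset L})) (hf : bijective f) (c : k),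
    sp_map a hf (iota0 K c) = iota0 L c;
  mu_assoc : forall (K : choiceType) (I R S T RS ST : {fset K})
    (dR_ST : decomp I R ST) (dST : decomp ST S T)
    (dRS_T : decomp I RS T) (dRS : decomp RS R S)
    (x : tensor (tensor (a K R) (a K S)) (a K T)),
    mu dRS_T (tensor_map (mu dRS) idfun x)
    = mu dR_ST (tensor_map idfun (mu dST) (tensor_assoc x));
  mu_unitl : forall (K : choiceType) (I : {fset K}) (d : decomp I fset0 I)
    (c : k) (u : a K I),
    mu d (tens (iota0 K c) u) = c *: u;
  mu_unitr : forall (K : choiceType) (I : {fset K}) (d : decomp I I fset0)
    (c : k) (u : a K I),
    mu d (tens u (iota0 K c)) = c *: u
}.

Record comonoid_structure (k : fieldType) (c : species k) : Type := Comonoid {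
  Delta : forall (K : choiceType) (I S T : {fset K}), decomp I S T ->
    {linear c K I -> tensor (c K S) (c K T)};
  eps0 : forall K : choiceType, {linear c K fset0 -> k^o};
  Delta_natural : forall (K L : choiceType)
    (I S T : {fset K}) (I' S' T' : {fset L})
    (d : decomp I S T) (d' : decomp I' S' T')
    (h : I -> I') (f : S -> S') (g : T -> T')
    (hh : bijective h) (hf : bijective f) (hg : bijective g),
    restricts h f -> restricts h g ->
    forall u : c K I,
      Delta d' (sp_map c hh u) = tensor_map (sp_map c hf) (sp_map c hg) (Delta d u);
  eps0_natural : forall (K L : choiceType)
    (f : (fset0 : {fset K}) -> (fset0 : {fset L})) (hf : bijective f)
    (u : c K fset0),
    eps0 L (sp_map c hf u) = eps0 K u;
  Delta_coassoc : forall (K : choiceType) (I R S T RS ST : {fset K})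
    (dR_ST : decomp I R ST) (dST : decomp ST S T)
    (dRS_T : decomp I RS T) (dRS : decomp RS R S) (u : c K I),
    tensor_map idfun (Delta dST) (Delta dR_ST u)
    = tensor_assoc (tensor_map (Delta dRS) idfun (Delta dRS_T u));
  Delta_counitl : forall (K : choiceType) (I : {fset K}) (d : decomp I fset0 I)
    (u : c K I),
    tensor_map (eps0 K) idfun (Delta d u) = tens (1 : k^o) u;
  Delta_counitr : forall (K : choiceType) (I : {fset K}) (d : decomp I I fset0)
    (u : c K I),
    tensor_map idfun (eps0 K) (Delta d u) = tens u (1 : k^o)
}.

(* The product and the unit are morphisms of comonoids. *)
Record bimonoid_axioms (k : fieldType) (h : species k)
    (m : monoid_structure h) (c : comonoid_structure h) : Prop := Bimonoid {
  (* the decompositions of S, T, S', T' below force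
     A = S `&` S', B = S `&` T', C = T `&` S', D = T `&` T' *)
  Delta_mu : forall (K : choiceType) (I S T S' T' A B C D : {fset K})
    (d : decomp I S T) (d' : decomp I S' T')
    (dS : decomp S A B) (dT : decomp T C D)
    (dS' : decomp S' A C) (dT' : decomp T' B D)
    (x : tensor (h K S) (h K T)),
    Delta c d' (mu m d x)
    = tensor_map (mu m dS') (mu m dT')
        (tensor_swap4 (tensor_map (Delta c dS) (Delta c dT) x));
  eps0_mu : forall (K : choiceType) (d : decomp fset0 fset0 fset0)
    (u v : h K fset0),
    eps0 c K (mu m d (tens u v)) = eps0 c K u * eps0 c K v;
  Delta_iota0 : forall (K : choiceType) (d : decomp fset0 fset0 fset0),
    Delta c d (iota0 m K 1) = tens (iota0 m K 1) (iota0 m K 1);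
  eps0_iota0 : forall K : choiceType, eps0 c K (iota0 m K 1) = 1
}.

(* dim h[fset0] = 1: there is a basis with one element *)
Definition connected_species (k : fieldType) (h : species k) : Prop :=
  forall K : choiceType, exists2 e : h K fset0, e != 0 &
    forall u : h K fset0, exists c : k, u = c *: e.

Section Compositions.
Variable K : choiceType.
Implicit Types (I : {fset K}) (F : seq {fset K}).

Definition is_composition I F : bool :=
  [&& all (fun A => A != fset0) F,
      pairwise (fun A B => [disjoint A & B]%fset) F
    & \bigcup_(A <- F) A == I].

Fixpoint words I (n : nat) : {fset seq {fset K}} :=
  if n is n'.+1 then
    [::] |` [fset A :: F | A in fpowerset I, F in words I n']
  else [fset [::]].

(* The finite set of all compositions of I; a composition of I has at most
   #|` I| blocks, see in_compositions. *)
Definition compositions I : {fset seq {fset K}} :=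
  [fset F in words I #|` I| | is_composition I F].

Lemma in_words I n F :
  (F \in words I n) = (size F <= n)%N && all (fun A => A `<=` I) F.
Proof.
elim: n F => [|n IHn] F /=; first by rewrite in_fset1 leqn0 size_eq0; case: F.
rewrite in_fset1U; case: F => [|A F] //=.
apply/imfset2P/idP => /= [[B hB [G hG [-> ->]]]|/andP[nF /andP[hA hF]]].
  by move: hB hG; rewrite /= fpowersetE IHn ltnS => -> /andP[-> ->].
exists A; first by rewrite /= fpowersetE.
by exists F; rewrite //= IHn -ltnS nF.
Qed.

Lemma is_composition_cons I A F : is_composition I (A :: F) ->
  is_composition (\bigcup_(B <- F) B) F /\ decomp I A (\bigcup_(B <- F) B).
Proof.
case/and3P=> /= /andP[_ F0] /andP[AF pF]; rewrite big_cons => AUF.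
split; first by rewrite /is_composition F0 pF eqxx.
rewrite /decomp AUF andbT; elim: F AF {F0 pF AUF} => [|B F IHF] /=.
  by rewrite big_nil fdisjointX0.
by case/andP=> AB AF; rewrite big_cons fdisjointXU AB IHF.
Qed.

Lemma is_composition_nil I : is_composition I [::] -> fset0 = I.
Proof. by case/and3P=> _ _; rewrite big_nil => /eqP. Qed.

Lemma is_composition_seq1 I A : is_composition I [:: A] -> A = I.
Proof. by case/and3P=> _ _; rewrite big_seq1 => /eqP. Qed.

Lemma in_compositions I F : (F \in compositions I) = is_composition I F.
Proof.
rewrite !inE /= in_words; case cF: (is_composition I F); rewrite ?andbF //.
rewrite andbT; elim: F I cF => [|A F IHF] I //= cF.
have [cF' /andP[dAF /eqP UI]] := is_composition_cons cF.
have /andP[sF iF] := IHF _ cF'.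
have A0 : (0 < #|` A|)%N.
  by case/and3P: cF => /= /andP[A0 _] _ _; rewrite cardfs_gt0.
apply/and3P; split.
- rewrite -UI cardfsU; move: dAF => /disjoint_fsetI0 ->.
  rewrite cardfs0 subn0; exact: (leq_add A0 sF).
- by rewrite -UI fsubsetUl.
- by apply: sub_all iF => B BF; rewrite -UI fsubsetU // BF orbT.
Qed.

End Compositions.

Section Series.
Variable k : fieldType.

Definition sfamily (p : species k) : Type :=
  forall (K : choiceType) (I : {fset K}), p K I.

Definition is_series (p : species k) (s : sfamily p) : Prop :=
  forall (K L : choiceType) (I : {fset K}) (J : {fset L})
    (sigma : I -> J) (hsigma : bijective sigma),
    sp_map p hsigma (s K I) = s L J.

(* a[I_1] (x) (a[I_2] (x) ... (x) a[I_n]) for F = [:: I_1; ...; I_n]; the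
   second case avoids a trailing factor k when n > 0 *)
Fixpoint itensor (p : species k) (K : choiceType) (F : seq {fset K}) :
    lmodType k :=
  match F with
  | [::] => k^o
  | [:: A] => p K A
  | A :: F' => tensor (p K A) (itensor p F')
  end.

(* s_F = s_{I_1} (x) ... (x) s_{I_n} *)
Fixpoint series_tens (p : species k) (s : sfamily p) (K : choiceType)
    (F : seq {fset K}) : itensor p F :=
  match F return itensor p F with
  | [::] => (1 : k^o)
  | A :: F' =>
    match F' return itensor p F' -> itensor p (A :: F') with
    | [::] => fun=> s K A
    | _ :: _ => fun u => tens (s K A) u
    end (series_tens s F')
  end.

Definition sp_cast (p : species k) (K : choiceType) (A B : {fset K})
    (e : A = B) : {linear p K A -> p K B} :=
  match e in _ = B return {linear p K A -> p K B} with erefl => idfun end.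

(* mu_F : a[I_1] (x) ... (x) a[I_n] -> a[I], bracketed to the right; it is the
   identity for n = 1 and iota for n = 0, up to the equality given by cF *)
Fixpoint mu_comp (a : species k) (m : monoid_structure a) (K : choiceType)
    (F : seq {fset K}) :
    forall I, is_composition I F -> {linear itensor a F -> a K I} :=
  match F return
    forall I, is_composition I F -> {linear itensor a F -> a K I} with
  | [::] => fun I cF =>
    (sp_cast a (is_composition_nil cF) \o iota0 m K)%FUN
  | A :: F' =>
    match F' return
      (forall I, is_composition I F' -> {linear itensor a F' -> a K I}) ->
      forall I, is_composition I (A :: F') ->
        {linear itensor a (A :: F') -> a K I} with
    | [::] => fun _ I cF => sp_cast a (is_composition_seq1 cF)
    | _ :: _ => fun mu_F' I cF =>
      (mu m (proj2 (is_composition_cons cF))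
         \o tensor_map idfun (mu_F' _ (proj1 (is_composition_cons cF))))%FUN
    end (@mu_comp a m K F')
  end.

Lemma compositionP (K : choiceType) (I : {fset K}) (F : compositions I) :
  is_composition I (val F).
Proof. by rewrite -in_compositions; apply: valP. Qed.

(* mu_F (s_F) *)
Definition mu_series (a : species k) (m : monoid_structure a) (s : sfamily a)
    (K : choiceType) (I : {fset K}) (F : compositions I) : a K I :=
  mu_comp m (compositionP F) (series_tens s (val F)).

Definition exp_series (a : species k) (m : monoid_structure a) (s : sfamily a) :
    sfamily a := fun K I =>
  \sum_(F : compositions I)
    ((size (val F))`!%:R : k)^-1 *: mu_series m s F.

Definition log_series (a : species k) (m : monoid_structure a) (t : sfamily a) :
    sfamily a := fun K I =>
  if I == fset0 then 0 else
  \sum_(F : compositions I)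
    ((-1) ^+ (size (val F)).-1 / (size (val F))%:R : k) *: mu_series m t F.

Definition null_series (a : species k) (s : sfamily a) : Prop :=
  is_series s /\ forall K : choiceType, s K fset0 = 0.

Definition unital_series (a : species k) (m : monoid_structure a)
    (t : sfamily a) : Prop :=
  is_series t /\ forall K : choiceType, t K fset0 = iota0 m K 1.

Definition group_like_series (c : species k) (d : comonoid_structure c)
    (g : sfamily c) : Prop :=
  [/\ is_series g,
      forall (K : choiceType) (I S T : {fset K}) (dI : decomp I S T),
        Delta d dI (g K I) = tens (g K S) (g K T)
    & forall K : choiceType, eps0 d K (g K fset0) = 1].

Definition primitive_series (c : species k) (d : comonoid_structure c)
    (x : sfamily c) : Prop :=
  [/\ is_series x,
      forall K : choiceType, x K fset0 = 0
    & forall (K : choiceType) (I S T : {fset K}) (dI : decomp I S T),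
        S != fset0 -> T != fset0 -> Delta d dI (x K I) = 0].

End Series.

Definition inverse_bijections (X Y : Type) (A : X -> Prop) (B : Y -> Prop)
    (f : X -> Y) (g : Y -> X) : Prop :=
  [/\ forall x, A x -> B (f x),
      forall y, B y -> A (g y),
      forall x, A x -> g (f x) = x
    & forall y, B y -> f (g y) = y].

(* Main.v *)
From HB Require Import structures.
Require Import Defs.
From mathcomp Require Import all_boot all_order all_algebra.
From mathcomp Require Import finmap boolp zify ring.

(* For a fixed ground type K, the families (s_I) indexed by the finite subsets
   I of K form a ring under the convolution
     (s * t)_I = sum over I = S + T of mu_{S,T} (s_S (x) t_T),
   and if s vanishes on the empty set, s ^+ n vanishes on sets with fewer than
   n elements. A power series can thus be evaluated at s, composition of power
   series corresponds to composition of evaluations, and grouping compositions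
   by length turns exp and log into the evaluations of the usual series at s and
   at t - 1. They are mutually inverse because the truncations E and L of e^X
   and log(1 + X) satisfy L(E - 1) = X and E(L) = 1 + X modulo X^{N+1}, which
   follows from the differential equations E' = E and L'(1 + X) = 1.

   In a connected bimonoid, Delta is multiplicative, and a series x is primitive
   when its coproduct is x (x) 1 + 1 (x) x. The divided powers e_n = x^n/n! then
   have coproduct sum_i e_i (x) e_{n-i}, so that exp x is group-like.
   Conversely, let exp x be group-like and let x be primitive on the proper
   subsets of I. Truncate x to x' by setting it to 0 outside these subsets; x'
   is primitive, so exp x' is group-like. Since exp x and exp x' agree on proper
   subsets of I and differ by x_I at I, Delta_{S,T} (x_I) = 0. *)

Set Implicit Arguments.
Unset Strict Implicit.
Unset Printing Implicit Defensive.

Import GRing.Theory.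
Local Open Scope fset_scope.
Local Open Scope ring_scope.

Lemma big_fset_only (J : choiceType) (V : nmodType) (A : {fset J}) (F : J -> V)
    j :
  j \in A -> (forall i, i != j -> F i = 0) -> \sum_(i <- A) F i = F j.
Proof.
move=> jA F0; rewrite (big_fsetD1 j) //= big1_seq ?addr0 // => i.
by rewrite !inE => /and3P[_ ij _]; apply: F0.
Qed.

(** * Decompositions of a finite set into two disjoint subsets *)

Section Decompositions.
Variable K : choiceType.
Implicit Types I S T R : {fset K}.

Lemma decompP I S T :
  reflect [/\ S `<=` I & T = I `\` S] (decomp I S T).
Proof.
apply: (iffP andP) => [[dST /eqP <-]|[sSI ->]].
  rewrite fsubsetUl fsetDUl fsetDv fset0U; split=> //.
  by apply/esym/fsetDidPl; rewrite fdisjoint_sym.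
split; last first.
  apply/eqP/fsetP => x; rewrite !inE; case: (boolP (x \in S)) => //= xS.
  by rewrite (fsubsetP sSI).
by apply/fdisjointP => x xS; rewrite inE xS.
Qed.

Lemma decompD I S : S `<=` I -> decomp I S (I `\` S).
Proof. by move=> sSI; apply/decompP. Qed.

Lemma decomp0l I : decomp I fset0 I.
Proof. by rewrite /decomp fdisjoint0X fset0U eqxx. Qed.

Lemma decomp0r I : decomp I I fset0.
Proof. by rewrite /decomp fdisjointX0 fsetU0 eqxx. Qed.

Lemma decomp_card I S T : decomp I S T -> #|` I| = (#|` S| + #|` T|)%N.
Proof.
case/andP=> /disjoint_fsetI0 dST /eqP <-.
by rewrite cardfsU dST cardfs0 subn0.
Qed.

End Decompositions.

(** * The convolution ring of families over a fixed ground type *)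

Section Convolution.
Variables (k : fieldType) (a : species k) (m : monoid_structure a).
Variable K : choiceType.
Implicit Types I S T R : {fset K}.

(* The product mu_{S,T}, extended by 0 to the triples with I <> S + T, so that
   sums over decompositions can be reindexed without carrying proofs. *)
Definition mprod I S T (x : a K S) (y : a K T) : a K I :=
  if @eqP _ (decomp I S T) true is ReflectT d then mu m d (tens x y) else 0.

Lemma mprodE I S T (d : decomp I S T) (x : a K S) (y : a K T) :
  mprod I x y = mu m d (tens x y).
Proof.
by rewrite /mprod; case: eqP => // d'; rewrite (bool_irrelevance d' d).
Qed.

Lemma mprod_eq0 I S T (x : a K S) (y : a K T) :
  ~~ decomp I S T -> mprod I x y = 0.
Proof. by rewrite /mprod => /negP; case: eqP. Qed.

Lemma mprod_bilinear I S T : is_bilinear (@mprod I S T).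
Proof.
have [d|nd] := boolP (decomp I S T); last first.
  by split=> [y|x] b u v; rewrite !mprod_eq0 // scaler0 addr0.
split=> [y|x] b u v; rewrite !(mprodE d);
  by rewrite (tensDl, tensDr) (tensZl, tensZr) linearP.
Qed.

(** Arguments swapped so that linearity in the left factor can be declared as an instance. *)
Definition mprodr I S T (y : a K T) (x : a K S) : a K I := mprod I x y.

HB.instance Definition _ I S T (y : a K T) :=
  GRing.isLinear.Build k (a K S) (a K I) _ (@mprodr I S T y)
    ((mprod_bilinear I S T).1 y).

HB.instance Definition _ I S T (x : a K S) :=
  GRing.isLinear.Build k (a K T) (a K I) _ (@mprod I S T x)
    ((mprod_bilinear I S T).2 x).

Lemma mprod0l I S T (y : a K T) : mprod I (0 : a K S) y = 0.
Proof. exact: (linear0 (mprodr I y)). Qed.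

Lemma mprod0r I S T (x : a K S) : mprod I x (0 : a K T) = 0.
Proof. exact: linear0. Qed.

Lemma mprod_suml I S T (J : Type) (r : seq J) (P : pred J)
    (F : J -> a K S) (y : a K T) :
  mprod I (\sum_(j <- r | P j) F j) y = \sum_(j <- r | P j) mprod I (F j) y.
Proof. exact: (linear_sum (mprodr I y)). Qed.

Lemma mprod_sumr I S T (J : Type) (r : seq J) (P : pred J)
    (F : J -> a K T) (x : a K S) :
  mprod I x (\sum_(j <- r | P j) F j) = \sum_(j <- r | P j) mprod I x (F j).
Proof. exact: linear_sum. Qed.

(** Unless [R], [S], [T] are pairwise disjoint with union [I], both sides vanish; otherwise this is
    [mu_assoc]. *)
Lemma mprodA I R S T (x : a K R) (y : a K S) (z : a K T) :
  mprod I (mprod (R `|` S) x y) z = mprod I x (mprod (S `|` T) y z).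
Proof.
have dE (A B : {fset K}) : decomp (A `|` B) A B = [disjoint A & B]%fset.
  by rewrite /decomp eqxx andbT.
have [dRS|nRS] := boolP [disjoint R & S]%fset; last first.
  rewrite [mprod (R `|` S) _ _]mprod_eq0 ?dE // mprod0l mprod_eq0 //.
  by apply: contra nRS => /andP[+ _]; rewrite fdisjointXU => /andP[].
have [dST|nST] := boolP [disjoint S & T]%fset; last first.
  rewrite [mprod (S `|` T) _ _]mprod_eq0 ?dE // mprod0r mprod_eq0 //.
  by apply: contra nST => /andP[+ _]; rewrite fdisjointUX => /andP[].
have eqd : decomp I (R `|` S) T = decomp I R (S `|` T).
  by rewrite /decomp fsetUA fdisjointXU fdisjointUX dRS dST andbT.
have [d|nd] := boolP (decomp I (R `|` S) T); last first.
  by rewrite !mprod_eq0 // -eqd.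
have d' := d; rewrite eqd in d'; rewrite -dE in dRS; rewrite -dE in dST.
rewrite (mprodE d) (mprodE d') (mprodE dRS) (mprodE dST).
have := mu_assoc m d' dST d dRS (tens (tens x y) z).
by rewrite tensor_map_tens tensor_assoc_tens tensor_map_tens.
Qed.

(* The monoid structure is a parameter because it determines the ring structure
   on families. *)
Definition family (_ : monoid_structure a) : Type := forall I, a K I.

HB.instance Definition _ := gen_eqMixin (family m).
HB.instance Definition _ := gen_choiceMixin (family m).

Implicit Types s t u : family m.

Definition fam_add s t : family m := fun I => s I + t I.
Definition fam_opp s : family m := fun I => - s I.
Definition fam_zero : family m := fun I => 0.
Definition fam_scale (c : k) s : family m := fun I => c *: s I.

Definition fam_one : family m := fun I =>
  if @eqP _ fset0 I is ReflectT e then sp_cast a e (iota0 m K 1) else 0.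

Definition fam_mul s t : family m := fun I =>
  \sum_(S <- fpowerset I) mprod I (s S) (t (I `\` S)).

Lemma famP s t : (forall I, s I = t I) -> s = t.
Proof. exact: functional_extensionality_dep. Qed.

Let addA : associative fam_add.
Proof. by move=> s t u; apply: famP => I; apply: addrA. Qed.
Let addC : commutative fam_add.
Proof. by move=> s t; apply: famP => I; apply: addrC. Qed.
Let add0 : left_id fam_zero fam_add.
Proof. by move=> s; apply: famP => I; apply: add0r. Qed.
Let addN : left_inverse fam_zero fam_opp fam_add.
Proof. by move=> s; apply: famP => I; apply: addNr. Qed.

HB.instance Definition _ :=
  GRing.isZmodule.Build (family m) addA addC add0 addN.

Let scaleA b c s : fam_scale b (fam_scale c s) = fam_scale (b * c) s.
Proof. by apply: famP => I; apply: scalerA. Qed.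
Let scale1 : left_id 1 fam_scale.
Proof. by move=> s; apply: famP => I; apply: scale1r. Qed.
Let scaleDr : right_distributive fam_scale +%R.
Proof. by move=> c s t; apply: famP => I; apply: scalerDr. Qed.
Let scaleDl s : {morph fam_scale^~ s : b c / b + c}.
Proof. by move=> b c; apply: famP => I; apply: scalerDl. Qed.

HB.instance Definition _ :=
  GRing.Zmodule_isLmodule.Build k (family m) scaleA scale1 scaleDr scaleDl.

(** [mprod] vanishes off decompositions, so the complement may become a free index; free indices
    allow the sums in [mulA] to be exchanged. *)
Lemma fam_mulE s t I : fam_mul s t I =
  \sum_(S <- fpowerset I) \sum_(T <- fpowerset I) mprod I (s S) (t T).
Proof.
apply: eq_big_seq => S; rewrite fpowersetE => sSI.
rewrite (big_fsetD1 (I `\` S)) ?fpowersetE ?fsubsetDl //=.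
rewrite [X in _ + X]big1_seq ?addr0 //.
move=> T; rewrite !inE => /and3P[_ TIS _].
by apply: mprod_eq0; apply: contra TIS => /decompP[_ ->].
Qed.

(** Gives a range independent of [I], for use when [I] is itself a summation index. *)
Lemma fam_mul_widen s t I U : I `<=` U -> fam_mul s t I =
  \sum_(S <- fpowerset U) \sum_(T <- fpowerset U) mprod I (s S) (t T).
Proof.
move=> sIU; have sP : fpowerset I `<=` fpowerset U by rewrite fpowersetS.
rewrite fam_mulE (big_fset_incl _ sP) /= => [|S _]; last first.
  rewrite fpowersetE => nSI; apply: big1 => T _; apply: mprod_eq0.
  by apply: contra nSI => /decompP[].
apply: eq_bigr => S _; rewrite (big_fset_incl _ sP) //= => T _.
rewrite fpowersetE => nTI; apply: mprod_eq0.
by apply: contra nTI => /decompP[_ ->]; apply: fsubsetDl.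
Qed.

Let mulA : associative fam_mul.
Proof.
move=> r s t; apply: famP => I; rewrite !fam_mulE.
(* Both sides are expanded over independent triples of subsets of [I]. For fixed [R], [S], [T] only
   one intermediate set contributes: the union of [S] and [T] on the left, of [R] and [S] on the
   right. *)
transitivity (\sum_(R <- fpowerset I) \sum_(S <- fpowerset I)
    \sum_(T <- fpowerset I) mprod I (r R) (mprod (S `|` T) (s S) (t T))).
  apply: eq_bigr => R _.
  under eq_big_seq => Y.
    rewrite fpowersetE => sYI; rewrite (fam_mul_widen _ _ sYI) mprod_sumr.
    under eq_bigr do rewrite mprod_sumr.
    over.
  rewrite exchange_big; apply: eq_big_seq => S; rewrite fpowersetE => sSI.
  rewrite exchange_big; apply: eq_big_seq => T; rewrite fpowersetE => sTI.
  apply: (big_fset_only (F := fun Y => mprod I (r R) (mprod Y (s S) (t T)))).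
    by rewrite fpowersetE fsubUset sSI.
  move=> Y ne; rewrite [mprod Y _ _]mprod_eq0 ?mprod0r //.
  by apply: contra ne => /andP[_]; rewrite eq_sym.
rewrite [RHS]exchange_big /=.
under [LHS]eq_bigr => R _ do rewrite exchange_big /=.
rewrite [LHS]exchange_big /=; apply: eq_big_seq => T; rewrite fpowersetE => sTI.
under [RHS]eq_big_seq => X.
  rewrite fpowersetE => sXI; rewrite (fam_mul_widen _ _ sXI) mprod_suml.
  under eq_bigr do rewrite mprod_suml.
  over.
rewrite [RHS]exchange_big; apply: eq_big_seq => R; rewrite fpowersetE => sRI.
rewrite [RHS]exchange_big; apply: eq_big_seq => S; rewrite fpowersetE => sSI.
rewrite -mprodA; apply/esym.
apply: (big_fset_only (F := fun X => mprod I (mprod X (r R) (s S)) (t T))).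
  by rewrite fpowersetE fsubUset sRI.
move=> X ne; rewrite [mprod X _ _]mprod_eq0 ?mprod0l //.
by apply: contra ne => /andP[_]; rewrite eq_sym.
Qed.

Lemma fam_one0 : fam_one fset0 = iota0 m K 1.
Proof.
by rewrite /fam_one; case: eqP => // e; rewrite (eq_irrelevance e erefl).
Qed.

Lemma fam_one_eq0 I : I != fset0 -> fam_one I = 0.
Proof. by rewrite /fam_one; case: eqP => // e /eqP[]. Qed.

Lemma mprod_onel I (x : a K I) : mprod I (fam_one fset0) x = x.
Proof. by rewrite (mprodE (decomp0l I)) fam_one0 mu_unitl scale1r. Qed.

Lemma mprod_oner I (x : a K I) : mprod I x (fam_one fset0) = x.
Proof. by rewrite (mprodE (decomp0r I)) fam_one0 mu_unitr scale1r. Qed.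

Let mul1 : left_id fam_one fam_mul.
Proof.
move=> s; apply: famP => I; rewrite /fam_mul.
rewrite (big_fset_only (j := fset0)) ?fpowersetE ?fsub0set //.
  by rewrite fsetD0 mprod_onel.
by move=> S S0; rewrite fam_one_eq0 // mprod0l.
Qed.

Let mulr1 : right_id fam_one fam_mul.
Proof.
move=> s; apply: famP => I; rewrite fam_mulE exchange_big.
rewrite (big_fset_only (j := fset0)) ?fpowersetE ?fsub0set //; last first.
  by move=> T T0; rewrite big1 // => S _; rewrite fam_one_eq0 // mprod0r.
rewrite (big_fset_only (j := I)) ?fpowersetE ?fsubset_refl ?mprod_oner //.
move=> S SI; apply: mprod_eq0; apply: contra SI => /andP[_].
by rewrite fsetU0.
Qed.

Let mulDl : left_distributive fam_mul +%R.
Proof.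
move=> s t u; apply: famP => I; rewrite -[RHS]big_split /=.
apply: eq_bigr => S _.
exact: (linearD (mprodr I (u (I `\` S)))).
Qed.

Let mulDr : right_distributive fam_mul +%R.
Proof.
move=> s t u; apply: famP => I; rewrite -[RHS]big_split /=.
apply: eq_bigr => S _; exact: (linearD (mprod I (s S))).
Qed.

HB.instance Definition _ :=
  GRing.Zmodule_isPzRing.Build (family m) mulA mul1 mulr1 mulDl mulDr.

Lemma fam_scaleAl (c : k) s t : c *: (s * t) = c *: s * t.
Proof.
apply: famP => I; rewrite /GRing.scale /= /fam_scale scaler_sumr.
apply: eq_bigr => S _; apply/esym.
exact: (linearZ_LR (mprodr I (t (I `\` S)))).
Qed.

Lemma fam_scaleAr (c : k) s t : c *: (s * t) = s * (c *: t).
Proof.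
apply: famP => I; rewrite /GRing.scale /= /fam_scale scaler_sumr.
apply: eq_bigr => S _; apply/esym.
exact: (linearZ_LR (mprod I (s S))).
Qed.

Lemma famD s t I : (s + t) I = s I + t I. Proof. by []. Qed.
Lemma famZ c s I : (c *: s) I = c *: s I. Proof. by []. Qed.
Lemma famM s t I : (s * t) I =
  \sum_(S <- fpowerset I) mprod I (s S) (t (I `\` S)).
Proof. by []. Qed.
Lemma fam1_0 : (1 : family m) fset0 = iota0 m K 1.
Proof. exact: fam_one0. Qed.
Lemma fam1_eq0 I : I != fset0 -> (1 : family m) I = 0.
Proof. exact: fam_one_eq0. Qed.

Lemma fam_sum (J : Type) (r : seq J) (P : pred J) (F : J -> family m) I :
  (\sum_(j <- r | P j) F j) I = \sum_(j <- r | P j) F j I.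
Proof.
by elim/big_rec2: _ => //= j x y _ <-.
Qed.

End Convolution.

(** * Evaluation of power series and polynomials at a family *)

Section FunctionalCalculus.
Variables (k : fieldType) (a : species k) (m : monoid_structure a).
Variable K : choiceType.
Implicit Types (I S T : {fset K}) (s t u : family K m) (c e : nat -> k).
Implicit Types p q : {poly k}.

(** Each of the [n] factors must take a nonempty block, which uses up at least [n] elements. *)
Lemma famX_card_eq0 s n I :
  s fset0 = 0 -> (#|` I| < n)%N -> (s ^+ n) I = 0.
Proof.
move=> s0; elim: n I => // n IHn I; rewrite ltnS => cI.
rewrite exprS famM big1_seq // => S; rewrite fpowersetE => /= sSI.
have [->|S0] := eqVneq S fset0; first by rewrite s0 mprod0l.
rewrite IHn ?mprod0r //; apply: leq_trans cI.
rewrite (decomp_card (decompD sSI)) -[X in (X < _)%N]add0n ltn_add2r.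
by rewrite cardfs_gt0.
Qed.

Lemma famX_local s t n I :
  (forall J, J `<=` I -> s J = t J) -> (s ^+ n) I = (t ^+ n) I.
Proof.
elim: n I => // n IHn I st; rewrite !exprS !famM.
apply: eq_big_seq => S; rewrite fpowersetE => sSI; rewrite st //.
rewrite IHn // => J sJ; apply: st.
exact: fsubset_trans sJ (fsubsetDl _ _).
Qed.

(** No factor can occupy all of [I]: the others, of which there is at least one, would be left with
    the empty set, where they vanish. *)
Lemma famX_local_proper s t n I : s fset0 = 0 -> t fset0 = 0 ->
  (forall J, J `<` I -> s J = t J) -> (s ^+ n.+2) I = (t ^+ n.+2) I.
Proof.
move=> s0 t0 st; rewrite ![_ ^+ n.+2]exprS !famM.
apply: eq_big_seq => S; rewrite fpowersetE => sSI.
have [->|S0] := eqVneq S fset0; first by rewrite s0 t0 !mprod0l.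
have [->|neSI] := eqVneq S I.
  by rewrite fsetDv !famX_card_eq0 ?cardfs0 // !mprod0r.
rewrite st ?fproperEneq ?neSI // (famX_local (t := t)) // => J sJ; apply: st.
apply: fsub_proper_trans sJ _.
rewrite fproperEcard fsubsetDl (decomp_card (decompD sSI)) -addn1 addnC.
by rewrite leq_add2r cardfs_gt0.
Qed.

(** The power series with coefficients [c] evaluated at [s]. If [s] vanishes on the empty set, the
    cutoff drops only zero terms, by [famX_card_eq0]. *)
Definition fcalc c s : family K m :=
  fun I => \sum_(n < #|` I|.+1) c n *: (s ^+ n) I.

Lemma fcalc_widen c s I N : s fset0 = 0 -> (#|` I| < N)%N ->
  fcalc c s I = \sum_(n < N) c n *: (s ^+ n) I.
Proof.
move=> s0 cIN; rewrite /fcalc (big_ord_widen N (fun n => c n *: (s ^+ n) I)) //.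
rewrite [RHS](bigID (fun n : 'I_N => (n < #|` I|.+1)%N)) /=.
rewrite [X in _ + X]big1 ?addr0 //.
by move=> n; rewrite -leqNgt => cn; rewrite famX_card_eq0 ?scaler0.
Qed.

Lemma eq_fcalc c e s I :
  (forall n, (n <= #|` I|)%N -> c n = e n) -> fcalc c s I = fcalc e s I.
Proof. by move=> ce; apply: eq_bigr => n _; rewrite ce // -ltnS. Qed.

Lemma fcalc0 c s : fcalc c s fset0 = c 0%N *: iota0 m K 1.
Proof. by rewrite /fcalc cardfs0 big_ord1 expr0 fam1_0. Qed.

Definition fam_horner s (p : {poly k}) : family K m :=
  \sum_(i < size p) p`_i *: s ^+ i.

Lemma fam_horner_widen s p N : (size p <= N)%N ->
  fam_horner s p = \sum_(i < N) p`_i *: s ^+ i.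
Proof.
move=> pN; rewrite /fam_horner (big_ord_widen N (fun i => p`_i *: s ^+ i)) //.
rewrite [RHS](bigID (fun i : 'I_N => (i < size p)%N)) /=.
rewrite [X in _ + X]big1 ?addr0 //.
by move=> i; rewrite -leqNgt => cn; rewrite nth_default ?scale0r.
Qed.

Lemma fam_horner_linear s : linear (fam_horner s).
Proof.
move=> b p q; pose N := maxn (size p) (size q).
rewrite !(@fam_horner_widen _ _ N) ?leq_maxl ?leq_maxr //; last first.
  apply: leq_trans (size_polyD _ _) _; rewrite geq_max leq_maxr andbT.
  exact: leq_trans (size_scale_leq _ _) (leq_maxl _ _).
rewrite scaler_sumr -big_split /=; apply: eq_bigr => i _.
by rewrite coefD coefZ scalerDl scalerA.
Qed.

HB.instance Definition _ s :=
  GRing.isLinear.Build k {poly k} (family K m) _ (fam_horner s)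
    (fam_horner_linear s).

Lemma fam_hornerC s b : fam_horner s b%:P = b *: (1 : family K m).
Proof.
by rewrite (fam_horner_widen _ (size_polyC_leq1 b)) big_ord1 coefC expr0.
Qed.

Lemma fam_hornerXM s p : fam_horner s ('X * p) = s * fam_horner s p.
Proof.
rewrite (@fam_horner_widen _ _ (size p).+1); last first.
  by apply: leq_trans (size_polyMleq _ _) _; rewrite size_polyX.
rewrite big_ord_recl coefXM /= scale0r add0r mulr_sumr.
by apply: eq_bigr => i _; rewrite coefXM /= exprS fam_scaleAr.
Qed.

(** The ring need not be commutative, but only powers of the single [s] and scalars, which are
    central, are involved. *)
Lemma fam_hornerM s p q :
  fam_horner s (p * q) = fam_horner s p * fam_horner s q.
Proof.
elim/poly_ind: p => [|p c IHp]; first by rewrite mul0r !linear0 mul0r.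
rewrite [p * 'X]mulrC mulrDl mul_polyC -mulrA !linearD linearZ.
rewrite /= !fam_hornerXM.
by rewrite IHp fam_hornerC mulrDl mulrA -fam_scaleAl mul1r.
Qed.

Lemma fam_hornerXn s p n : fam_horner s (p ^+ n) = fam_horner s p ^+ n.
Proof.
elim: n => [|n IHn]; last by rewrite !exprS fam_hornerM IHn.
by rewrite !expr0 fam_hornerC scale1r.
Qed.

Lemma fam_horner_fcalc s p I : s fset0 = 0 ->
  fam_horner s p I = fcalc (fun n => p`_n) s I.
Proof.
move=> s0; pose N := maxn (size p) #|` I|.+1.
rewrite (@fcalc_widen _ _ _ N) ?leq_maxr //.
rewrite (@fam_horner_widen _ _ N) ?leq_maxl //.
by rewrite fam_sum.
Qed.

Lemma fam_horner_comp s p q :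
  fam_horner s (p \Po q) = fam_horner (fam_horner s q) p.
Proof.
rewrite comp_polyE linear_sum; apply: eq_bigr => i _.
by rewrite linearZ /= fam_hornerXn.
Qed.

(** At [I] and its subsets only degrees up to the cardinality of [I] matter, so both series may be
    truncated to polynomials, for which [fam_horner_comp] applies. The condition [e 0 = 0] makes the
    inner value vanish on the empty set. *)
Lemma fcalc_comp c e s I : s fset0 = 0 -> e 0%N = 0 ->
  let trunc f := \poly_(n < #|` I|.+1) f n in
  fcalc c (fcalc e s) I = fcalc (fun n => (trunc c \Po trunc e)`_n) s I.
Proof.
move=> s0 e0 trunc; rewrite -fam_horner_fcalc // fam_horner_comp.
have truncE f n : (n <= #|` I|)%N -> (trunc f)`_n = f n.
  by rewrite coef_poly ltnS => ->.
rewrite fam_horner_fcalc; last first.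
  by rewrite fam_horner_fcalc // fcalc0 truncE // e0 scale0r.
rewrite -(eq_fcalc _ (truncE c)); apply: eq_bigr => i _; congr (_ *: _).
apply: famX_local => J sJI; rewrite fam_horner_fcalc //.
apply: eq_fcalc => n nJ; rewrite truncE //.
by rewrite (leq_trans nJ) // fsubset_leq_card.
Qed.

End FunctionalCalculus.

(** * Composition of the truncated exponential and logarithm *)

Section ExpLogPolynomials.
Variables (k : fieldType) (char0 : [pchar k] =i pred0).
Implicit Types N n i : nat.

Definition exp_coef n : k := (n`!%:R)^-1.
Definition expm1_coef n : k := if n is 0 then 0 else exp_coef n.
(* The value at 0 is 1 / 0 = 0. *)
Definition log_coef n : k := (-1) ^+ n.-1 / n%:R.

Lemma natS_neq0 n : n.+1%:R != 0 :> k.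
Proof. by rewrite (proj1 (pcharf0P k) char0). Qed.

Lemma mulrSn_eq0 (x : k) n : x *+ n.+1 = 0 -> x = 0.
Proof.
by move/eqP; rewrite -mulr_natr mulf_eq0 (negPf (natS_neq0 n)) orbF => /eqP.
Qed.

Lemma log_coef0 : log_coef 0 = 0.
Proof. by rewrite /log_coef invr0 mulr0. Qed.

Lemma exp_coefS n : exp_coef n.+1 * n.+1%:R = exp_coef n.
Proof.
by rewrite /exp_coef factS natrM invfM mulrAC mulVf ?natS_neq0 ?mul1r.
Qed.

Definition exp_poly N := \poly_(n < N.+1) exp_coef n.
Definition expm1_poly N := \poly_(n < N.+1) expm1_coef n.
Definition log_poly N := \poly_(n < N.+1) log_coef n.

Lemma expm1_polyE N : expm1_poly N = exp_poly N - 1.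
Proof.
apply/polyP => -[|n]; rewrite coefB !coef_poly coef1 /=.
  by rewrite /exp_coef invr1 subrr.
by rewrite subr0.
Qed.

(** The correction is the top term, which would arise from the truncated degree N+1. *)
Lemma deriv_exp_poly N : (exp_poly N)^`() = exp_poly N - exp_coef N *: 'X^N.
Proof.
apply/polyP => n; rewrite coef_deriv coefB coefZ coefXn !coef_poly !ltnS.
case: ltngtP => [nN|nN|->]; rewrite ?mulr0 ?mul0rn ?subr0 //.
  by rewrite -mulr_natr exp_coefS.
by rewrite mulr1 subrr.
Qed.

(** The derivative is the geometric sum of the powers of [- 'X] below N, and the factor [1 + 'X]
    makes it telescope. *)
Lemma deriv_log_poly N : (log_poly N)^`() * (1 + 'X) = 1 - (- 'X) ^+ N.
Proof.
have -> : (log_poly N)^`() = \sum_(i < N) (- 'X) ^+ i.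
  rewrite (eq_bigr (fun i : 'I_N => (-1) ^+ i *: 'X^i)); last first.
    by move=> i _; rewrite -mul_polyC polyC_exp polyCN [LHS]exprNn.
  rewrite -(poly_def N (fun i => (-1) ^+ i)).
  apply/polyP => n; rewrite coef_deriv !coef_poly ltnS.
  case: ifP => _; last by rewrite mul0rn.
  by rewrite -mulr_natr /log_coef /= divfK ?natS_neq0.
by rewrite mulrC -[LHS]opprK -mulNr opprD addrC -subrX1 opprB.
Qed.

Lemma dvdX_coef0 (p : {poly k}) : p`_0 = 0 -> exists q, p = 'X * q.
Proof.
move=> p0; exists (\poly_(i < size p) p`_i.+1); apply/polyP => -[|n].
  by rewrite coefXM.
rewrite coefXM /= coef_poly; case: ltnP => // sp.
by rewrite nth_default // (leq_trans sp).
Qed.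

Lemma comp_poly_coef0 (p q : {poly k}) : q`_0 = 0 -> (p \Po q)`_0 = p`_0.
Proof.
by rewrite -!horner_coef0 horner_comp => ->.
Qed.

(** By the chain rule the derivative of the composite is 1 modulo X^N; in characteristic 0 this
    determines the coefficients of degree 1 to N. *)
Lemma coef_log_exp N n : (n <= N)%N ->
  (log_poly N \Po expm1_poly N)`_n = (n == 1)%N%:R.
Proof.
have e0 : (expm1_poly N)`_0 = 0 by rewrite coef_poly.
case: n => [|n nN]; first by rewrite comp_poly_coef0 // coef_poly log_coef0.
have [g eg] := dvdX_coef0 e0.
set P := _ \Po _.
have [q dP] : exists q, P^`() = 1 + 'X^N * q.
  have eE : 1 + expm1_poly N = exp_poly N by rewrite expm1_polyE addrC subrK.
  have := congr1 (comp_poly (expm1_poly N)) (deriv_log_poly N).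
  rewrite comp_polyM comp_polyD comp_polyB -[1]polyC1 !comp_polyC comp_polyX.
  rewrite polyC1 eE.
  rewrite rmorphXn /= rmorphN /= comp_polyX.
  rewrite [X in (- X) ^+ _]eg -mulrN exprMn => dL.
  (* With E - 1 = X g, the two terms are the errors in the equations for L' and for E', each divided
     by X^N. *)
  exists (- (- g) ^+ N - ((log_poly N)^`() \Po expm1_poly N) * (exp_coef N)%:P).
  rewrite /P deriv_comp [(expm1_poly N)^`()](_ : _ = (exp_poly N)^`()).
    rewrite deriv_exp_poly -mul_polyC mulrBr dL; ring.
  by rewrite expm1_polyE derivB derivC subr0.
apply: (mulIf (natS_neq0 n)).
rewrite mulr_natr -coef_deriv dP coefD coef1 coefXnM nN addr0.
by case: n {nN} => [|n]; rewrite ?mul1r ?mul0r.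
Qed.

(** The composite P satisfies P'(1 + X) = P modulo X^N with P(0) = 1, and this recursion on
    coefficients has 1 + X as its only solution up to degree N. *)
Lemma coef_exp_log N n : (n <= N)%N ->
  (exp_poly N \Po log_poly N)`_n = (n <= 1)%N%:R.
Proof.
have l0 : (log_poly N)`_0 = 0 by rewrite coef_poly log_coef0.
have [g lg] := dvdX_coef0 l0.
set P := _ \Po _.
have P0 : P`_0 = 1 by rewrite comp_poly_coef0 // coef_poly /= /exp_coef invr1.
have [q dP] : exists q, P^`() * (1 + 'X) = P + 'X^N * q.
  have := congr1 (comp_poly (log_poly N)) (deriv_exp_poly N).
  rewrite !rmorphB /= linearZ /= rmorphXn /= comp_polyX -/P {2}lg exprMn => dE.
  (* With L = X g, this is the error in (P - c L^N)(1 - (-X)^N) relative to P, divided by X^N, where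
     c is the top coefficient of E. *)
  exists (- (-1) ^+ N * P - exp_coef N *: (g ^+ N * (1 - (- 'X) ^+ N))).
  rewrite deriv_comp -mulrA deriv_log_poly dE -!mul_polyC [(- 'X) ^+ N]exprNn.
  ring.
elim: n => [|n IHn] nN //.
have := congr1 (fun p : {poly k} => p`_n) dP.
rewrite mulrDr mulr1 coefD coefMX coefD coefXnM nN addr0.
rewrite IHn ?(ltnW nN) // !coef_deriv.
(* The recursion reads (n+1) p_{n+1} + n p_n = p_n. The cases n = 0 and n = 1 are separate because
   p_0 and p_1 are the nonzero coefficients. *)
case: n nN IHn => [|n] nN IHn /=.
  by rewrite mulr1n addr0.
rewrite IHn ?(ltnW nN) //; case: n nN {IHn} => [|n] nN /=.
  by rewrite mulr1n => /(canRL (addrK _)); rewrite subrr => /mulrSn_eq0.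
by rewrite mul0rn addr0 => /mulrSn_eq0.
Qed.

End ExpLogPolynomials.

(** * Sums over compositions as evaluations of power series *)

Section CompositionSums.
Variables (k : fieldType) (a : species k) (m : monoid_structure a).
Variable K : choiceType.
Implicit Types (I S T A B : {fset K}) (F G : seq {fset K}) (s t : family K m).

(** Blocks of compositions are nonempty, so exp and log see a family only through this part; for a
    unital [t] it is [t - 1]. *)
Definition positive_part s : family K m :=
  fun I => if I == fset0 then 0 else s I.

Lemma positive_part0 s : positive_part s fset0 = 0.
Proof. by rewrite /positive_part eqxx. Qed.

Lemma positive_part_unital t :
  t fset0 = iota0 m K 1 -> 1 + positive_part t = t.
Proof.
move=> t0; apply: famP => I; rewrite famD /positive_part.
by case: eqVneq => [->|I0]; rewrite ?fam1_0 ?addr0 // fam1_eq0 // add0r.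
Qed.

Lemma positive_part_exp s :
  positive_part (fcalc (@exp_coef k) s) = fcalc (@expm1_coef k) s.
Proof.
apply: famP => I; rewrite /positive_part; case: eqVneq => [->|I0].
  by rewrite fcalc0 scale0r.
rewrite /fcalc !big_ord_recl !expr0 fam1_eq0 // !scaler0.
by [].
Qed.

Lemma is_composition_consE I A F : is_composition I (A :: F) =
  [&& A != fset0, A `<=` I & is_composition (I `\` A) F].
Proof.
apply/idP/and3P => [cF|[A0 sAI]].
  have [cF' dA] := is_composition_cons cF; have /decompP[sAI <-] := dA.
  by split=> //; case/and3P: cF => /= /andP[].
case/and3P=> F0 pF /eqP UF; apply/and3P; split=> /=; first by rewrite A0.
  rewrite pF andbT; apply/allP => B BF.
  have /fdisjointP dA : [disjoint A & I `\` A]%fset.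
    by have /andP[] := decompD sAI.
  apply/fdisjointP => x /dA; apply: contra => xB; rewrite -UF.
  by apply/bigfcupP; exists B; rewrite ?BF.
by rewrite big_cons UF; have /andP[] := decompD sAI.
Qed.

(** The element mu_F(s_F), written with the total product [mprod] so that no proof that [F] is a
    composition is carried. *)
Fixpoint comp_prod s F I : a K I :=
  if F is A :: F' then mprod m I (s A) (comp_prod s F' (\bigcup_(B <- F') B))
  else (1 : family K m) I.

Lemma mu_comp_prod (s : sfamily a) I F (cF : is_composition I F) :
  mu_comp m cF (series_tens s F) = comp_prod (s K) F I.
Proof.
elim: F I cF => [|A F IHF] I cF.
  rewrite /= /GRing.one /= /fam_one; case: eqP => [e|ne].
    by rewrite (eq_irrelevance e (is_composition_nil cF)).
  by case: ne; apply: is_composition_nil.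
case: F IHF cF => [|B F] IHF cF.
  (* [mu_comp] stops at the last block while [comp_prod] ends with the unit family, which is
     absorbed here. *)
  rewrite /= big_nil; case: _ / (is_composition_seq1 cF).
  by rewrite mprod_oner.
transitivity (mprod m I (s K A)
  (comp_prod (s K) (B :: F) (\bigcup_(C <- B :: F) C))) => //.
rewrite (mprodE _ (proj2 (is_composition_cons cF))).
rewrite -(IHF _ (proj1 (is_composition_cons cF))).
by rewrite -[tens (s K A) _](tensor_map_tens idfun).
Qed.

(** Expanding the power chooses [n] successive blocks, and choices with an empty block vanish. The
    induction splits off the first block. *)
Lemma famX_comp s n I : (positive_part s ^+ n) I =
  \sum_(F <- compositions I | size F == n) comp_prod s F I.
Proof.
elim: n I => [|n IHn] I.
  rewrite expr0 big_mkcond; have [->|I0] := eqVneq I fset0.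
    rewrite (big_fset_only (j := [::])) ?in_compositions //.
      by rewrite /is_composition /= big_nil eqxx.
    by move=> F; rewrite -size_eq0 => /negPf->.
  rewrite fam1_eq0 // big1_seq // => F /= FI; case: eqP => // /size0nil F0.
  move: FI I0; rewrite F0 in_compositions => /is_composition_nil <-.
  by rewrite eqxx.
rewrite exprS famM (bigID (fun A => A == fset0)) /= big1 ?add0r; last first.
  by move=> A /eqP ->; rewrite positive_part0 mprod0l.
under eq_bigr => A A0.
  rewrite /positive_part (negPf A0) IHn mprod_sumr.
  over.
pose comps A := [seq F <- compositions (I `\` A) | size F == n].
pose blocks : seq {fset K} := [seq A <- fpowerset I | A != fset0].
transitivity
  (\sum_(F <- [seq A :: F | A <- blocks, F <- comps A]) comp_prod s F I).
  rewrite big_allpairs_dep big_filter big_seq_cond [RHS]big_seq_cond.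
  apply: eq_bigr => A /andP[]; rewrite fpowersetE => sAI A0.
  rewrite big_filter big_seq_cond [RHS]big_seq_cond; apply: eq_bigr => F.
  by rewrite in_compositions /= => /andP[/and3P[_ _ /eqP ->]].
rewrite -[RHS]big_filter; apply: perm_big; apply: uniq_perm.
- apply: allpairs_uniq_dep; first by rewrite filter_uniq ?fset_uniq.
    by move=> A _; rewrite filter_uniq ?fset_uniq.
  by move=> [A F] [B G] _ _ /= [-> ->].
- by rewrite filter_uniq ?fset_uniq.
move=> F; apply/allpairsPdep/idP => [[A [G [+ + ->]]]|].
  rewrite !mem_filter fpowersetE !in_compositions is_composition_consE.
  by move=> /andP[-> ->] /andP[/eqP <- ->] /=; rewrite eqxx.
rewrite mem_filter in_compositions; case: F => [|A F] //.
rewrite is_composition_consE eqSS => /and4P[sF A0 sAI cF].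
by exists A, F; rewrite !mem_filter A0 sF fpowersetE sAI in_compositions cF.
Qed.

(** Compositions are grouped by length, which is at most the cardinality of [I], so the cutoff in
    [fcalc] loses none of them. *)
Lemma mu_series_sum (c : nat -> k) (s : sfamily a) I :
  \sum_(F : compositions I) c (size (val F)) *: mu_series m s F =
  fcalc c (positive_part (s K)) I.
Proof.
under eq_bigr do rewrite /mu_series mu_comp_prod.
rewrite -(big_seq_fsetE _ _ predT
  (fun F => c (size F) *: comp_prod (s K) F I)) /=.
under [RHS]eq_bigr do rewrite famX_comp scaler_sumr.
rewrite (exchange_big_dep predT) //=; apply: eq_big_seq => F FI.
have sF : (size F < #|` I|.+1)%N.
  by move: FI; rewrite !inE in_words ltnS => /andP[/andP[]].
by rewrite (big_pred1 (Ordinal sF)).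
Qed.

Lemma exp_seriesE (s : sfamily a) I :
  exp_series m s I = fcalc (@exp_coef k) (positive_part (s K)) I.
Proof. exact: (mu_series_sum (@exp_coef k)). Qed.

Lemma log_seriesE (t : sfamily a) I :
  log_series m t I = fcalc (@log_coef k) (positive_part (t K)) I.
Proof.
rewrite /log_series; case: eqVneq => [->|_].
  (* The prescribed value 0 on the empty set matches the vanishing constant coefficient. *)
  by rewrite fcalc0 log_coef0 scale0r.
exact: (mu_series_sum (@log_coef k)).
Qed.

Hypothesis char0 : [pchar k] =i pred0.

Lemma fcalc_log_exp s : s fset0 = 0 ->
  fcalc (@log_coef k) (fcalc (@expm1_coef k) s) = s.
Proof.
move=> s0; apply: famP => I; rewrite fcalc_comp //.
rewrite (eq_fcalc _ (coef_log_exp char0 (N := _))).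
have [->|I0] := eqVneq I fset0; first by rewrite fcalc0 scale0r.
rewrite /fcalc; move: I0; rewrite -cardfs_gt0; case: #|` I| => // N _.
rewrite !big_ord_recl big1 => [|i _]; last by rewrite scale0r.
by rewrite scale0r scale1r add0r addr0.
Qed.

Lemma fcalc_exp_log s : s fset0 = 0 ->
  fcalc (@exp_coef k) (fcalc (@log_coef k) s) = 1 + s.
Proof.
move=> s0; apply: famP => I; rewrite fcalc_comp ?log_coef0 //.
rewrite (eq_fcalc _ (coef_exp_log char0 (N := _))) famD.
have [->|I0] := eqVneq I fset0; first by rewrite fcalc0 s0 addr0 scale1r fam1_0.
rewrite /fcalc; move: I0; rewrite -cardfs_gt0; case: #|` I| => // N _.
rewrite !big_ord_recl big1 => [|i _]; last by rewrite scale0r.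
by rewrite !scale1r addr0.
Qed.

End CompositionSums.

(** * Transport of subsets along a bijection *)

Section Transport.
Variables (K L : choiceType) (I : {fset K}) (J : {fset L}).
Variables (h : I -> J) (hh : bijective h).
Implicit Types S : {fset K}.

Definition transport S : {fset L} := [fset val (h x) | x : I & val x \in S].

Lemma mem_transport (x : I) S : (val (h x) \in transport S) = (val x \in S).
Proof.
apply/imfsetP/idP => [[y /= yS /val_inj/(bij_inj hh) ->] //|xS].
by exists x.
Qed.

Lemma transport_sub S : transport S `<=` J.
Proof. by apply/fsubsetP => y /imfsetP[x _ ->]; apply: valP. Qed.

Lemma transportD S : S `<=` I -> transport (I `\` S) = J `\` transport S.
Proof.
move=> sSI; apply/fsetP => y; rewrite [RHS]in_fsetD.
have [yJ|yJ] := boolP (y \in J); last first.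
  by rewrite !andbF; apply: contraNF yJ; apply/fsubsetP/transport_sub.
have [h' _ h'K] := hh.
have -> : y = val (h (h' [` yJ])) by rewrite h'K.
by rewrite !mem_transport inE !fsvalP !andbT.
Qed.

Lemma perm_transport :
  perm_eq [seq transport A | A <- fpowerset I] (fpowerset J).
Proof.
have [h' hK h'K] := hh.
apply: uniq_perm; rewrite ?fset_uniq //.
  rewrite map_inj_in_uniq ?fset_uniq // => S T.
  rewrite !fpowersetE => sSI sTI eST; apply/fsetP => x.
  have [xI|xI] := boolP (x \in I).
    by have := mem_transport [` xI] S; rewrite eST mem_transport.
  by rewrite (contraNF (fsubsetP sSI x) xI) (contraNF (fsubsetP sTI x) xI).
move=> T; rewrite fpowersetE; apply/mapP/idP => [[A _ ->]|sTJ].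
  exact: transport_sub.
exists [fset val x | x : I & val (h x) \in T].
  by rewrite fpowersetE; apply/fsubsetP => y /imfsetP[x _ ->]; apply: valP.
apply/fsetP => y; have [yJ|yJ] := boolP (y \in J); last first.
  rewrite (contraNF (fsubsetP sTJ y) yJ).
  by rewrite (contraNF (fsubsetP (transport_sub _) y) yJ).
have -> : y = val (h (h' [` yJ])) by rewrite h'K.
rewrite mem_transport; apply/idP/imfsetP => [yT|[x /= xT /val_inj ->] //].
by exists (h' [` yJ]).
Qed.

(** Supplies the bijections between blocks that [mu_natural] requires. *)
Lemma transport_restricts S : S `<=` I ->
  exists2 f : S -> transport S, bijective f & restricts h f.
Proof.
move=> sSI; have [h' hK h'K] := hh.
have fP (x : S) : val (h (fincl sSI x)) \in transport S.
  by rewrite mem_transport; apply: (fsvalP x).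
have gP (y : transport S) : val (h' (fincl (transport_sub S) y)) \in S.
  by rewrite -mem_transport h'K; apply: (fsvalP y).
exists (fun x => [` fP x]); last first.
  move=> i x ix /=; congr (val (h _)); exact: val_inj.
exists (fun y => [` gP y]) => [x|y]; apply: val_inj => /=.
  rewrite (_ : fincl _ _ = h (fincl sSI x)) ?hK //; exact: val_inj.
rewrite (_ : fincl _ _ = h' (fincl (transport_sub S) y)) ?h'K //.
exact: val_inj.
Qed.

End Transport.

(** * Naturality of exp and log, and their inversion on series *)

Section SeriesNaturality.
Variables (k : fieldType) (a : species k) (m : monoid_structure a).
Implicit Types s t : sfamily a.

(** Decompositions of the target are the images of those of the source, and [mu_natural] matches the
    terms. *)
Lemma is_series_mul s t : is_series s -> is_series t ->
  is_series (fun K => (s K : family K m) * t K).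
Proof.
move=> s_ser t_ser K L I J h hh; rewrite !famM linear_sum.
rewrite -(perm_big _ (perm_transport hh)) big_map.
apply: eq_big_seq => S; rewrite fpowersetE => sSI.
have [f hf rf] := transport_restricts hh sSI.
have [g hg rg] := transport_restricts hh (fsubsetDl I S).
have d' := decompD (transport_sub h S).
rewrite -transportD // in d' *.
rewrite (mprodE _ (decompD sSI)) (mprodE _ d').
by rewrite (mu_natural m _ d' hh hf hg rf rg) tensor_map_tens s_ser t_ser.
Qed.

Lemma bij_fset0 (K L : choiceType) (I : {fset K}) (J : {fset L}) (h : I -> J) :
  bijective h -> (I == fset0) = (J == fset0).
Proof.
move=> hh; rewrite -!cardfs_eq0 !cardfE.
by rewrite (bij_eq_card hh).
Qed.

Lemma is_series_positive_part s : is_series s ->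
  is_series (fun K => positive_part (s K : family K m)).
Proof.
move=> s_ser K L I J h hh; rewrite /positive_part (bij_fset0 hh).
by case: ifP => _; [apply: linear0 | apply: s_ser].
Qed.

Lemma is_series_one : is_series (fun K => (1 : family K m)).
Proof.
move=> K L I J h hh; have [I0|I0] := eqVneq I fset0; last first.
  by rewrite !fam1_eq0 ?linear0 // -(bij_fset0 hh).
have /eqP J0 : J == fset0 by rewrite -(bij_fset0 hh) I0.
subst I J; rewrite !fam1_0; exact: iota0_natural.
Qed.

Lemma is_series_exp s n : is_series s ->
  is_series (fun K => (s K : family K m) ^+ n).
Proof.
move=> s_ser; elim: n => [|n IHn]; first exact: is_series_one.
rewrite (_ : (fun K => _) =
  fun K => (s K : family K m) * (s K : family K m) ^+ n).
  exact: is_series_mul.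
by apply: functional_extensionality_dep => K; rewrite exprS.
Qed.

Lemma is_series_fcalc (c : nat -> k) s : is_series s ->
  is_series (fun K => fcalc c (s K : family K m)).
Proof.
move=> s_ser K L I J h hh; rewrite /fcalc linear_sum.
have -> : #|` J| = #|` I| by rewrite !cardfE (bij_eq_card hh).
apply: eq_bigr => n _; rewrite linearZ /=; congr (_ *: _).
exact: (is_series_exp n s_ser).
Qed.

Lemma is_series_exp_series s : is_series s -> is_series (exp_series m s).
Proof.
move=> s_ser K L I J h hh; rewrite !exp_seriesE.
exact: (is_series_fcalc _ (is_series_positive_part s_ser)).
Qed.

Lemma is_series_log_series s : is_series s -> is_series (log_series m s).
Proof.
move=> s_ser K L I J h hh; rewrite !log_seriesE.
exact: (is_series_fcalc _ (is_series_positive_part s_ser)).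
Qed.

Lemma sfamilyP s t : (forall K I, s K I = t K I) -> s = t.
Proof.
move=> st; apply: functional_extensionality_dep => K.
exact: functional_extensionality_dep.
Qed.

Hypothesis char0 : [pchar k] =i pred0.

Lemma positive_part_id (K : choiceType) (u : family K m) :
  u fset0 = 0 -> positive_part u = u.
Proof.
by move=> u0; apply: famP => I; rewrite /positive_part; case: eqP => // ->.
Qed.

Lemma exp_log_inverse :
  inverse_bijections (@null_series k a) (unital_series m)
    (exp_series m) (log_series m).
Proof.
split=> [s [s_ser s0]|t [t_ser t0]|s [s_ser s0]|t [t_ser t0]].
- split=> [|K]; first exact: is_series_exp_series.
  by rewrite exp_seriesE fcalc0 /exp_coef invr1 scale1r.
- split=> [|K]; first exact: is_series_log_series.
  by rewrite log_seriesE fcalc0 log_coef0 scale0r.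
- apply: sfamilyP => K I; rewrite log_seriesE.
  have -> : exp_series m s = fun K => fcalc (@exp_coef k) (s K : family K m).
    by apply: sfamilyP => K' I'; rewrite exp_seriesE positive_part_id.
  (* Dropping the value of exp(s) on the empty set subtracts 1, as the series log(1 + X) expects. *)
  by rewrite positive_part_exp fcalc_log_exp.
apply: sfamilyP => K I; rewrite exp_seriesE positive_part_id; last first.
  by rewrite log_seriesE fcalc0 log_coef0 scale0r.
have -> : log_series m t = fun K =>
    fcalc (@log_coef k) (positive_part (t K : family K m)).
  by apply: sfamilyP => K' I'; rewrite log_seriesE.
rewrite fcalc_exp_log // ?positive_part0 //.
by rewrite positive_part_unital.
Qed.

End SeriesNaturality.

(** * Tensors of finite sums *)

Section TensorSums.
Variables (k : fieldType) (V W : lmodType k).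

Definition tensr (w : W) (v : V) : tensor V W := tens v w.

HB.instance Definition _ (w : W) :=
  GRing.isLinear.Build k V (tensor V W) _ (tensr w) ((tens_bilinear V W).1 w).

HB.instance Definition _ (v : V) :=
  GRing.isLinear.Build k W (tensor V W) _ (@tens k V W v)
    ((tens_bilinear V W).2 v).

Lemma tens0l (w : W) : tens (0 : V) w = 0.
Proof. exact: (linear0 (tensr w)). Qed.

Lemma tens0r (v : V) : tens v (0 : W) = 0.
Proof. exact: linear0. Qed.

Lemma tens_suml (J : Type) (r : seq J) (F : J -> V) (w : W) :
  tens (\sum_(j <- r) F j) w = \sum_(j <- r) tens (F j) w.
Proof. exact: (linear_sum (tensr w)). Qed.

Lemma tens_sumr (J : Type) (r : seq J) (F : J -> W) (v : V) :
  tens v (\sum_(j <- r) F j) = \sum_(j <- r) tens v (F j).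
Proof. exact: linear_sum. Qed.

End TensorSums.

(** Both sides run over i + j < M; the induction adds the antidiagonal i + j = M. *)
Lemma sum_triangle (V : zmodType) (f : nat -> nat -> V) M :
  \sum_(n < M) \sum_(i < n.+1) f i (n - i)%N =
  \sum_(i < M) \sum_(j < M - i) f i j.
Proof.
elim: M => [|M IHM]; first by rewrite !big_ord0.
rewrite big_ord_recr IHM [RHS]big_ord_recr /= [X in _ + X]big_ord_recr /=.
rewrite addrA -big_split /= subSnn big_ord1 subnn; congr (_ + _).
by apply: eq_bigr => i _; rewrite subSn ?big_ord_recr // ltnW.
Qed.

(** * Primitive and group-like families in a connected bimonoid *)

Section Coproducts.
Variables (k : fieldType) (h : species k).
Variables (m : monoid_structure h) (c : comonoid_structure h).
Hypotheses (bim : bimonoid_axioms m c) (conn : connected_species h).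
Variable K : choiceType.
Implicit Types (I S T A B : {fset K}) (s t x : family K m).

Lemma decomp_eq0l I T : decomp I fset0 T -> T = I.
Proof. by move=> /andP[_ /eqP <-]; rewrite fset0U. Qed.

Lemma decomp_eq0r I S : decomp I S fset0 -> S = I.
Proof. by move=> /andP[_ /eqP <-]; rewrite fsetU0. Qed.

(** The component on the empty set is a line, and [eps0] sends the unit to 1, so [eps0] and [iota0]
    are inverse there. *)
Lemma connected_eps (u : h K fset0) : u = (eps0 c K u : k) *: iota0 m K 1.
Proof.
have [e e0 eP] := conn K; have [b ub] := eP u; have [b' ib] := eP (iota0 m K 1).
have := eps0_iota0 bim K; rewrite ib linearZ /= => eps1.
rewrite ub scalerA; congr (_ *: _).
have -> : eps0 c K (b *: e) = b * eps0 c K e :> k by rewrite linearZ.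
by rewrite -mulrA [X in b * X]mulrC [X in b * X]eps1 mulr1.
Qed.

(** By [connected_eps], applying [eps0] and then [iota0] to the left factor changes nothing, while
    the counit axiom computes the first of these maps. *)
Lemma Delta_fset0l I T (d : decomp I fset0 T) s :
  Delta c d (s I) = tens ((1 : family K m) fset0) (s T).
Proof.
have eT := decomp_eq0l d; subst T; rewrite fam1_0.
rewrite -[iota0 m K 1]/(iota0 m K (1 : k^o)) -[s I in RHS]/(idfun (s I)).
rewrite -(tensor_map_tens (iota0 m K) idfun) -(Delta_counitl c d).
set u := Delta c d _.
pose f := (tensor_map (iota0 m K) (idfun : {linear h K I -> _}) \o
  tensor_map (eps0 c K) (idfun : {linear h K I -> _}))%FUN.
apply: (@tensor_lift_linearP _ _ _ _ idfun f) => [||v w].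
- exact: linearP.
- exact: linearP.
rewrite /f /= !tensor_map_tens /= {1}[v]connected_eps -linearZ.
by rewrite /GRing.scale /= mulr1.
Qed.

Lemma Delta_fset0r I S (d : decomp I S fset0) s :
  Delta c d (s I) = tens (s S) ((1 : family K m) fset0).
Proof.
have eT := decomp_eq0r d; subst S; rewrite fam1_0.
rewrite -[iota0 m K 1]/(iota0 m K (1 : k^o)) -[s I in RHS]/(idfun (s I)).
rewrite -(tensor_map_tens idfun (iota0 m K)) -(Delta_counitr c d).
set u := Delta c d _.
pose f := (tensor_map (idfun : {linear h K I -> _}) (iota0 m K) \o
  tensor_map (idfun : {linear h K I -> _}) (eps0 c K))%FUN.
apply: (@tensor_lift_linearP _ _ _ _ idfun f) => [||v w].
- exact: linearP.
- exact: linearP.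
rewrite /f /= !tensor_map_tens /= {1}[w]connected_eps -linearZ.
by rewrite /GRing.scale /= mulr1.
Qed.

(** [D] is a formal sum of pairs of families, in the role of an element of the tensor square of the
    convolution ring. *)
Definition has_coproduct s (D : seq (family K m * family K m)) : Prop :=
  forall I S T (d : decomp I S T),
    Delta c d (s I) = \sum_(p <- D) tens (p.1 S) (p.2 T).

Lemma has_coproduct1 : has_coproduct 1 [:: (1, 1)].
Proof.
move=> I S T d; rewrite big_seq1 /=.
have [S0|S0] := eqVneq S fset0; first by subst S; apply: Delta_fset0l.
have [T0|T0] := eqVneq T fset0; first by subst T; apply: Delta_fset0r.
rewrite [X in tens X]fam1_eq0 // tens0l fam1_eq0 ?linear0 //.
apply: contra S0 => /eqP I0; rewrite -fsubset0 -I0.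
by have /decompP[] := d.
Qed.

(** The inverse cuts a subset of [I] into its traces on [S] and [T]. *)
Lemma perm_fpowerset_decomp I S T : decomp I S T ->
  perm_eq [seq A `|` B | A <- fpowerset S, B <- fpowerset T] (fpowerset I).
Proof.
move=> /andP[dST /eqP <-].
have cutl A B : A `<=` S -> B `<=` T -> (A `|` B) `&` S = A.
  move=> sA sB; rewrite fsetIUl (fsetIidPl sA) (_ : B `&` S = fset0) ?fsetU0 //.
  by apply/disjoint_fsetI0; rewrite fdisjoint_sym; apply: fdisjointWr dST.
have cutr A B : A `<=` S -> B `<=` T -> (A `|` B) `&` T = B.
  move=> sA sB; rewrite fsetIUl (fsetIidPl sB) (_ : A `&` T = fset0) ?fset0U //.
  by apply/disjoint_fsetI0; apply: fdisjointWl dST.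
apply: uniq_perm; rewrite ?fset_uniq //.
  apply: allpairs_uniq; rewrite ?fset_uniq // => -[A B] [A' B'] /=.
  move=> /allpairsP[[a b] /= [+ + [-> ->]]]
          /allpairsP[[a' b'] /= [+ + [-> ->]]].
  rewrite !fpowersetE => sa sb sa' sb' e.
  congr (_, _); first by rewrite -(cutl a b) // e cutl.
  by rewrite -(cutr a b) // e cutr.
move=> X; rewrite fpowersetE; apply/allpairsP/idP => [[[A B] [/= + + ->]]|sX].
  by rewrite !fpowersetE; apply: fsetUSS.
exists (X `&` S, X `&` T); rewrite !fpowersetE !fsubsetIr; split=> //.
by rewrite -fsetIUr; apply/esym/fsetIidPl.
Qed.

(** A subset of [I] splits as [A] in [S] and [B] in [T], and its complement as the two remainders;
    these are the four parts in [Delta_mu]. *)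
Lemma has_coproductM s t D E : has_coproduct s D -> has_coproduct t E ->
  has_coproduct (s * t) [seq (p.1 * q.1, p.2 * q.2) | p <- D, q <- E].
Proof.
move=> sD tE I S T d; rewrite famM linear_sum.
rewrite -(perm_big _ (perm_fpowerset_decomp d)) /= !big_allpairs_dep.
under [RHS]eq_bigr => p _.
  under eq_bigr => q _.
    rewrite /= !famM tens_suml.
    under eq_bigr do rewrite tens_sumr.
    over.
  rewrite exchange_big.
  over.
rewrite [RHS]exchange_big; apply: eq_big_seq => A; rewrite fpowersetE => sAS.
under [RHS]eq_bigr do rewrite exchange_big.
rewrite [RHS]exchange_big; apply: eq_big_seq => B; rewrite fpowersetE => sBT.
have dS' := decompD sAS; have dT' := decompD sBT.
have [dST /eqP UST] := andP d.
have dAB : decomp (A `|` B) A B.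
  rewrite /decomp eqxx andbT; exact: fdisjointWl sAS (fdisjointWr sBT dST).
have sABI : A `|` B `<=` I by rewrite -UST fsetUSS.
have dCD : decomp (I `\` (A `|` B)) (S `\` A) (T `\` B).
  apply/andP; split.
    exact: fdisjointWl (fsubsetDl _ _) (fdisjointWr (fsubsetDl _ _) dST).
  apply/eqP/fsetP => z; rewrite -UST !inE.
  move/fdisjointP: dST => /(_ z).
  move: (fsubsetP sAS z) (fsubsetP sBT z).
  by case: (z \in A); case: (z \in B); case: (z \in S); case: (z \in T);
    move=> // a b e;
    solve [by have := a isT | by have := b isT | by have := e isT].
rewrite (mprodE _ (decompD sABI)).
rewrite (Delta_mu bim (decompD sABI) d dAB dCD dS' dT') tensor_map_tens.
rewrite (sD _ _ _ dAB) (tE _ _ _ dCD) tens_suml [tensor_swap4 _]linear_sum.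
rewrite [LHS]linear_sum /=.
apply: eq_bigr => p _.
rewrite tens_sumr [tensor_swap4 _]linear_sum [LHS]linear_sum /=.
apply: eq_bigr => q _.
by rewrite /= tensor_swap4_tens tensor_map_tens !(mprodE _ dS') !(mprodE _ dT').
Qed.

Definition primitive_family x : Prop :=
  x fset0 = 0 /\ forall I S T (d : decomp I S T),
    S != fset0 -> T != fset0 -> Delta c d (x I) = 0.

Lemma primitive_coproduct x :
  primitive_family x -> has_coproduct x [:: (x, 1); (1, x)].
Proof.
move=> [x0 xP] I S T d; rewrite big_cons big_seq1 /=.
have [S0|S0] := eqVneq S fset0.
  by subst S; rewrite x0 tens0l add0r Delta_fset0l.
have [T0|T0] := eqVneq T fset0.
  by subst T; rewrite x0 tens0r addr0 Delta_fset0r.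
by rewrite xP // !fam1_eq0 // tens0l tens0r addr0.
Qed.

Hypothesis char0 : [pchar k] =i pred0.

Definition divided_power x n : family K m := exp_coef k n *: x ^+ n.

Lemma divided_powerS x n :
  x * divided_power x n = n.+1%:R *: divided_power x n.+1.
Proof.
by rewrite /divided_power -fam_scaleAr -exprS scalerA mulrC exp_coefS.
Qed.

(** Induction through [divided_powerS]: x e_n = (n+1) e_{n+1}, where n+1 can be cancelled in
    characteristic 0. *)
Lemma divided_power_coproduct x n : primitive_family x ->
  has_coproduct (divided_power x n)
    [seq (divided_power x i, divided_power x (n - i)) | i <- index_iota 0 n.+1].
Proof.
move=> xP; elim: n => [|n IHn].
  rewrite /= /divided_power !expr0 /exp_coef invr1 !scale1r.
  exact: has_coproduct1.
move=> I S T d; apply: (scalerI (natS_neq0 char0 n)).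
rewrite -linearZ -[_ *: _]/((n.+1%:R *: divided_power x n.+1) I).
rewrite -divided_powerS.
rewrite (has_coproductM (primitive_coproduct xP) IHn) big_allpairs_dep.
rewrite big_cons big_seq1.
rewrite !big_map !big_mkord scaler_sumr.
pose f i := tens (divided_power x i S) (divided_power x (n.+1 - i) T).
(* The first sum comes from x (x) 1, the second from 1 (x) x. The terms added at i = 0 and at i =
   n+1 respectively have coefficient 0, and the two coefficients add up to n+1. *)
transitivity (\sum_(i < n.+2) (i%:R : k) *: f i +
              \sum_(i < n.+2) ((n.+1 - i)%:R : k) *: f i).
  congr (_ + _).
    rewrite [RHS]big_ord_recl scale0r add0r; apply: eq_bigr => i _ /=.
    by rewrite mul1r divided_powerS famZ tensZl.
  rewrite [RHS]big_ord_recr /= subnn scale0r addr0; apply: eq_bigr => i _ /=.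
  rewrite mul1r divided_powerS famZ tensZr /f subSn //.
  by rewrite -ltnS.
rewrite -big_split /=; apply: eq_bigr => i _.
by rewrite -scalerDl -natrD subnKC // -ltnS.
Qed.

(** The coproduct sums e_i (x) e_j over a triangle, the tensor product over a square; the terms in
    between vanish. *)
Lemma exp_primitive_group_like x : primitive_family x ->
  forall I S T (d : decomp I S T),
    let g := fcalc (@exp_coef k) x in Delta c d (g I) = tens (g S) (g T).
Proof.
move=> xP I S T d /=; have x0 := xP.1.
pose N := (#|` S| + #|` T|)%N.
pose f i j := tens (divided_power x i S) (divided_power x j T).
(* Here i exceeds the size of [S] or j that of [T]. *)
have f0 i j : (N < i + j)%N -> f i j = 0.
  move=> Nij; have [Si|iS] := ltnP #|` S| i.
    by rewrite /f /divided_power famZ famX_card_eq0 // scaler0 tens0l.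
  rewrite /f /divided_power [X in tens _ X]famZ.
  rewrite [X in tens _ (_ *: X)]famX_card_eq0 ?scaler0 ?tens0r //.
  by move: Nij; rewrite /N -ltn_subLR; lia.
transitivity (\sum_(i < N.+1) \sum_(j < N.+1) f i j); last first.
  rewrite (@fcalc_widen _ _ _ _ _ _ S N.+1) ?ltnS ?leq_addr //.
  rewrite (@fcalc_widen _ _ _ _ _ _ T N.+1) ?ltnS ?leq_addl //.
  by rewrite tens_suml; apply: eq_bigr => i _; rewrite tens_sumr.
rewrite /fcalc (decomp_card d) linear_sum.
transitivity (\sum_(n < N.+1) \sum_(i < n.+1) f i (n - i)%N).
  apply: eq_bigr => n _; rewrite (divided_power_coproduct n xP d).
  by rewrite big_map big_mkord.
rewrite sum_triangle; apply: eq_bigr => i _.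
rewrite (big_ord_widen N.+1 (f i)) ?leq_subr // big_mkcond.
apply: eq_bigr => j _; case: ltnP => // ij.
by rewrite f0 //; move: ij; lia.
Qed.

(** The constant terms cancel, and those of degree at least 2 cancel by [famX_local_proper]; the
    linear term remains. *)
Lemma fcalc_exp_proper x x' I : x fset0 = 0 -> x' fset0 = 0 ->
  (forall J, J `<` I -> x J = x' J) ->
  fcalc (@exp_coef k) x I - fcalc (@exp_coef k) x' I = x I - x' I.
Proof.
move=> x0 x'0 xx'; have [->|I0] := eqVneq I fset0.
  by rewrite !fcalc0 x0 x'0 !subrr.
rewrite /fcalc; move: I0; rewrite -cardfs_gt0; case: #|` I| => // n _.
rewrite !big_ord_recl /= !expr0 !expr1 /exp_coef invr1 !scale1r.
rewrite [X in _ - (_ + (_ + X))](eq_bigr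
  (fun i : 'I_n => ((bump 0 (bump 0 i))`!%:R : k)^-1
                     *: (x ^+ bump 0 (bump 0 i)) I)).
  by rewrite opprD addrACA subrr add0r opprD addrACA subrr addr0.
by move=> i _; rewrite (famX_local_proper _ x0 x'0).
Qed.

Lemma log_group_like_primitive x : x fset0 = 0 ->
  (forall I S T (d : decomp I S T),
    let g := fcalc (@exp_coef k) x in Delta c d (g I) = tens (g S) (g T)) ->
  primitive_family x.
Proof.
move=> x0 gP; split=> // I.
have [n] := ubnP #|` I|; elim: n I => // n IHn I; rewrite ltnS.
move=> cI S T d S0 T0.
(* [x'] is primitive everywhere: by induction on proper subsets of [I], trivially elsewhere. *)
pose x' : family K m := fun J => if J `<` I then x J else 0.
have x'0 : x' fset0 = 0 by rewrite /x'; case: ifP.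
have x'P : primitive_family x'.
  split=> // J A B dJ A0 B0; rewrite /x'; case: ifP => JI; last exact: linear0.
  by apply: IHn => //; apply: leq_trans cI; apply: fproper_ltn_card.
have pS : S `<` I.
  rewrite fproperEcard (decomp_card d) -addn1 leq_add2l cardfs_gt0 T0 andbT.
  by have /decompP[] := d.
have pT : T `<` I.
  rewrite fproperEcard (decomp_card d) -add1n leq_add2r cardfs_gt0 S0 andbT.
  by have /andP[_ /eqP <-] := d; apply: fsubsetUr.
have same J : J `<` I -> fcalc (@exp_coef k) x' J = fcalc (@exp_coef k) x J.
  move=> JI; apply: eq_bigr => i _; congr (_ *: _); apply: famX_local => A AJ.
  by rewrite /x' (fsub_proper_trans AJ JI).
(* As [S] and [T] are proper, both exponentials have the same coproduct at [I], so [Delta] kills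
   their difference, which is [x I]. *)
have := gP _ _ _ d; have := exp_primitive_group_like x'P d.
rewrite /= (same S pS) (same T pT) => <- /eqP; rewrite -subr_eq0 -linearB.
rewrite fcalc_exp_proper // => [|J JI]; last by rewrite /x' JI.
by rewrite /x' (negPf (fproper_irrefl I)) subr0 => /eqP.
Qed.

End Coproducts.

(** * The bijections for monoids and their restriction to connected bimonoids *)

Theorem theorem69 (k : fieldType) (char0 : [pchar k]%R =i pred0) :
  (forall (a : species k) (m : monoid_structure a),
    inverse_bijections (@null_series k a) (unital_series m)
      (exp_series m) (log_series m))
  /\
  (forall (h : species k) (m : monoid_structure h) (c : comonoid_structure h),
    bimonoid_axioms m c -> connected_species h ->
    [/\ forall x : sfamily h, primitive_series c x -> null_series x,
        forall g : sfamily h, group_like_series c g -> unital_series m g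
      & inverse_bijections (primitive_series c) (group_like_series c)
          (exp_series m) (log_series m)]).
Proof.
split=> [a m|h m c bim conn]; first exact: exp_log_inverse.
have primN x : primitive_series c x -> null_series x by case.
have glU g : group_like_series c g -> unital_series m g.
  move=> [g_ser _ eg]; split=> // K.
  (* By connectedness, counit 1 forces the value on the empty set to be the unit. *)
  by rewrite [LHS](connected_eps bim conn) eg scale1r.
have [expU logN expK logK] := exp_log_inverse m char0.
have expE x K I : null_series x ->
    exp_series m x I = fcalc (@exp_coef k) (x K : family K m) I.
  by move=> [_ x0]; rewrite exp_seriesE positive_part_id.
split=> //; split=> [x xP|g gP|x /primN/expK|g /glU/logK] //.
- have xN := primN x xP; have [e_ser e1] := expU x xN.
  split=> // [K I S T d|K]; last by rewrite e1 (eps0_iota0 bim).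
  rewrite !expE //; apply: (exp_primitive_group_like bim conn char0) => //.
  by case: xP => _ x0 xP; split; [exact: x0 | exact: xP].
have gU := glU g gP; have lN := logN g gU; have [l_ser l0] := lN.
have prim K : primitive_family c (@log_series k h m g K : family K m).
  apply: (log_group_like_primitive bim conn char0); first exact: l0.
  (* The exponential of log g is g, so the criterion reduces to g being group-like. *)
  move=> I S T d /=; rewrite -!expE // logK //.
  by case: gP => _ + _; apply.
by split=> // K I S T d; apply: (prim K).2.
Qed.
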